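(* Let $\mathcal P$ be a locally trivial quantum principal fibre bundle whose Hopf algebra $H$ has bijective antipode, with a differential structure $\Gamma(\mathcal P)$. Let $D_{l}$ ($D_r$) be a left (right) covariant derivative with left (right) curvature form $\Omega_l$ ($\Omega_r$), let $\alpha_{l}$ ($\alpha_r$) be a left (right) gauge transformation with corresponding map $g_{\alpha_l}$ ($g_{\alpha_r}$) $:H\to\mathcal P$, and let $\Omega'_l$ ($\Omega'_r$) be the curvature form of the transformed covariant derivative $D'_{l,r}=\alpha_{l,r}\circ D_{l,r}\circ\alpha_{l,r}^{-1}$. Then for all $h\in H$ $$\Omega'_l(h)=\sum g_{\alpha_l^{-1}}(h_1)\,\Omega_l(h_2)\,g_{\alpha_l}(h_3),\qquad \Omega'_r(h)=\sum g_{\alpha_r}(h_3)\,\Omega_r(h_2)\,g_{\alpha_r^{-1}}(h_1).$$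
   Context: Bundles. Algebras are unital and associative over $\mathbb C$. A covering of an algebra $B$ is a finite family $(J_i)_{i\in I}$ of two-sided ideals with $\bigcap_i J_i=0$; $B_i=B/J_i$, $B_{ij}=B/(J_i+J_j)$, with quotient maps $\pi_i:B\to B_i$, $\pi^i_j:B_i\to B_{ij}$. It is complete if $b\mapsto(\pi_i(b))_i$ maps $B$ onto $\{(b_i)\mid \pi^i_j(b_i)=\pi^j_i(b_j)\}$. A locally trivial quantum principal fibre bundle consists of an algebra $B$ with complete covering $(J_i)_{i\in I}$, a Hopf algebra $H$, a right $H$-comodule algebra $\mathcal P$ with coaction $\Delta_{\mathcal P}$, an injective homomorphism $\iota:B\to\mathcal P$, and surjective homomorphisms $\chi_i:\mathcal P\to B_i\otimes H$ with $\chi_i(\iota(b))=\pi_i(b)\otimes 1$, $(\chi_i\otimes id)\circ\Delta_{\mathcal P}=(id\otimes\Delta)\circ\chi_i$, and $(\ker\chi_i)_i$ a complete covering of $\mathcal P$. Gauge transformations. A left (right) gauge transformation on $B_i\otimes H$ is an isomorphism $\alpha$ of left (right) $(B_i\otimes1)$-modules with $(\alpha\otimes id)(id\otimes\Delta)=(id\otimes\Delta)\alpha$ and $\alpha(a\otimes1)=a\otimes1$. A left (right) gauge transformation on $\mathcal P$ is an isomorphism $\alpha:\mathcal P\to\mathcal P$ of left (right) $\iota(B)$-modules such that for all $i$ there is a left (right) gauge transformation $\alpha_i$ on $B_i\otimes H$ with $\chi_i\circ\alpha=\alpha_i\circ\chi_i$. Such $\alpha$ correspond bijectively to linear maps $g_\alpha:H\to\mathcal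 P$ with $g_\alpha(1)=1$ and: (left) $\alpha_l(f)=\sum f_0g_{\alpha_l}(f_1)$, $\Delta_{\mathcal P}(g_{\alpha_l}(h))=\sum g_{\alpha_l}(h_2)\otimes S(h_1)h_3$, $\sum g_{\alpha_l}(h_1)g_{\alpha_l^{-1}}(h_2)=\sum g_{\alpha_l^{-1}}(h_1)g_{\alpha_l}(h_2)=\varepsilon(h)1$; (right) $\alpha_r(f)=\sum g_{\alpha_r}(f_1)f_0$, $\Delta_{\mathcal P}(g_{\alpha_r}(h))=\sum g_{\alpha_r}(h_2)\otimes h_3S^{-1}(h_1)$, $\sum g_{\alpha_r}(h_2)g_{\alpha_r^{-1}}(h_1)=\sum g_{\alpha_r^{-1}}(h_2)g_{\alpha_r}(h_1)=\varepsilon(h)1$. Here $\Delta_{\mathcal P}(f)=\sum f_0\otimes f_1$. Differential structures. A differential algebra $\Gamma(A)$ over an algebra $A$ is a differential graded algebra with $\Gamma^0(A)=A$ generated by $A$ and $dA$, i.e. a quotient of the universal one $\Omega(A)$. Given differential algebras $\Gamma(B_i)$ and a right covariant differential algebra $\Gamma(H)$, let $J_i(\mathcal P)$ be the kernel of the map $\Omega(\mathcal P)\to\Gamma(B_i)\hat\otimes\Gamma(H)$ (graded tensor product) induced by $\chi_i$. The differential structure on $\mathcal P$ is $\Gamma(\mathcal P)=\Omega(\mathcal P)/\bigcap_iJ_i(\mathcal P)$. Let $\chi_{i_\Gamma}:\Gamma(\mathcal P)\to\Gamma(B_i)\hat\otimes\Gamma(H)$ be the induced surjections, $K_i$ their kernels.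 $\Gamma_c(\mathcal P)$ is the algebra of families $(\gamma_i)_i$, $\gamma_i\in\Gamma(B_i)\hat\otimes\Gamma(H)\cong\Gamma(\mathcal P)/K_i$, such that $\gamma_i,\gamma_j$ have equal image in $\Gamma(\mathcal P)/(K_i+K_j)$; it is a differential graded algebra containing $\Gamma(\mathcal P)$, $\Gamma^0_c(\mathcal P)=\mathcal P$, and $\chi_{i_\Gamma}$ extends to it as $i$-th projection. $hor\,\Gamma_c(\mathcal P)=\{\gamma\mid\chi_{i_\Gamma}(\gamma)\in\Gamma(B_i)\hat\otimes H\ \forall i\}$, with right coaction $\gamma\mapsto\sum\gamma_0\otimes\gamma_1\in hor\,\Gamma_c(\mathcal P)\otimes H$ extending $\Delta_{\mathcal P}$, given locally by $id\otimes\Delta$. $\Gamma_m(B)=\{\gamma\in\Gamma_c(\mathcal P)\mid\chi_{i_\Gamma}(\gamma)\in\Gamma(B_i)\hat\otimes1\ \forall i\}$. Gauge transformations act bijectively on $hor\,\Gamma_c(\mathcal P)$ by $\alpha_l(\gamma)=\sum\gamma_0g_{\alpha_l}(\gamma_1)$, $\alpha_r(\gamma)=\sum g_{\alpha_r}(\gamma_1)\gamma_0$. A left (right) covariant derivative is a linear map $D$ of degree $1$ on $hor\,\Gamma_c(\mathcal P)$ with $D(1)=0$, commuting with the coaction, $D(\ker\chi_{i_\Gamma}\cap hor\,\Gamma_c(\mathcal P))\subset\ker\chi_{i_\Gamma}$ for all $i$, and $D(\rho\gamma)=(d\rho)\gamma+(-1)^n\rho D(\gamma)$ for $\rho\in\Gamma^n_m(B)$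 (left), respectively $D(\gamma\rho)=D(\gamma)\rho+(-1)^n\gamma\,d\rho$ for $\gamma$ of degree $n$ and $\rho\in\Gamma_m(B)$ (right). If $D$ is a covariant derivative, so is $\alpha\circ D\circ\alpha^{-1}$. The curvature form of $D_l$ ($D_r$) is the (unique) linear map $\Omega_{l}$ ($\Omega_r$) $:H\to hor\,\Gamma^2_c(\mathcal P)$ with $D_l^2(f)=\sum f_0\,\Omega_l(f_1)$, respectively $D_r^2(f)=\sum\Omega_r(f_1)\,f_0$, for all $f\in\mathcal P$. *)

(* Defs.v *)
From HB Require Import structures.
From mathcomp Require Import all_boot all_order all_algebra.
From mathcomp Require Import zify.
From mathcomp Require Import boolp.

Set Implicit Arguments.
Unset Strict Implicit.
Unset Printing Implicit Defensive.
Import GRing.Theory.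
Local Open Scope ring_scope.

(* Unital associative algebras.  [algType] is not used because it excludes the
   zero algebra, whereas quotients such as B/(J_i+J_j) may well vanish. *)
HB.mixin Record Lmodule_isUAlgebra (K : pzRingType) A of GRing.Lmodule K A := {
  uone : A;
  umul : A -> A -> A;
  umulA : associative umul;
  umul1l : left_id uone umul;
  umul1r : right_id uone umul;
  umulDl : left_distributive umul +%R;
  umulDr : right_distributive umul +%R;
  uscaleAl : forall (a : K) (x y : A), a *: umul x y = umul (a *: x) y;
  uscaleAr : forall (a : K) (x y : A), a *: umul x y = umul x (a *: y)
}.

#[short(type="ualgType")]
HB.structure Definition UAlgebra (K : pzRingType) :=
  { A of GRing.Lmodule K A & Lmodule_isUAlgebra K A }.

#[non_forgetful_inheritance]
HB.instance Definition _ (K : pzRingType) (A : ualgType K) :=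
  GRing.Zmodule_isPzRing.Build (UAlgebra.sort A)
    (@umulA K A) (@umul1l K A) (@umul1r K A) (@umulDl K A) (@umulDr K A).

Lemma uscalerAl (K : pzRingType) (A : ualgType K) (a : K) (x y : A) :
  a *: (x * y) = (a *: x) * y.
Proof. exact: uscaleAl. Qed.

Lemma uscalerAr (K : pzRingType) (A : ualgType K) (a : K) (x y : A) :
  a *: (x * y) = x * (a *: y).
Proof. exact: uscaleAr. Qed.

Record alghom (K : fieldType) (A B : ualgType K) := AlgHom {
  ahom_fun :> A -> B;
  ahom_linear : linear ahom_fun;
  ahom1 : ahom_fun 1 = 1;
  ahomM : forall x y, ahom_fun (x * y) = ahom_fun x * ahom_fun y
}.

HB.instance Definition _ (K : fieldType) (A B : ualgType K) (f : alghom A B) :=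
  GRing.isZmodMorphism.Build A B (ahom_fun f) (zmod_morphism_linear (@ahom_linear K A B f)).
HB.instance Definition _ (K : fieldType) (A B : ualgType K) (f : alghom A B) :=
  GRing.isScalable.Build K A B *:%R (ahom_fun f) (scalable_linear (@ahom_linear K A B f)).

Section AlghomTheory.
Variables (K : fieldType) (A B : ualgType K) (f : alghom A B).
Lemma ahom0 : f 0 = 0. Proof. exact: (linear0 f). Qed.
Lemma ahomD x y : f (x + y) = f x + f y. Proof. exact: (linearD f). Qed.
Lemma ahomN x : f (- x) = - f x. Proof. exact: (linearN f). Qed.
Lemma ahomB x y : f (x - y) = f x - f y. Proof. exact: (linearB f). Qed.
Lemma ahomZ a x : f (a *: x) = a *: f x. Proof. exact: (scalable_linear (@ahom_linear K A B f)). Qed.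
Lemma ahom_sum I (r : seq I) (P : pred I) F :
  f (\sum_(i <- r | P i) F i) = \sum_(i <- r | P i) f (F i).
Proof. exact: (linear_sum f). Qed.
End AlghomTheory.

Section Ideals.
#[local] Obligation Tactic := idtac.
Variable K : fieldType.

(* Two-sided ideals; closure under scalars follows from closure under
   multiplication by the elements c *: 1. *)
Record ideal (A : ualgType K) := Ideal {
  ideal_mem :> A -> Prop;
  ideal0 : ideal_mem 0;
  idealD : forall x y, ideal_mem x -> ideal_mem y -> ideal_mem (x + y);
  idealMl : forall a x, ideal_mem x -> ideal_mem (a * x);
  idealMr : forall a x, ideal_mem x -> ideal_mem (x * a)
}.

Lemma idealN (A : ualgType K) (J : ideal A) x : J x -> J (- x).
Proof. by move=> Jx; rewrite -mulN1r; apply: idealMl. Qed.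

Lemma idealB (A : ualgType K) (J : ideal A) x y : J x -> J y -> J (x - y).
Proof. by move=> Jx Jy; apply: idealD => //; apply: idealN. Qed.

Lemma idealZ (A : ualgType K) (J : ideal A) c x : J x -> J (c *: x).
Proof. by move=> Jx; rewrite -[x]mul1r uscalerAl; apply: idealMl. Qed.

Program Definition ideal_add (A : ualgType K) (J L : ideal A) : ideal A :=
  @Ideal A (fun x => exists y z, [/\ J y, L z & x = y + z]) _ _ _ _.
Next Obligation.
by move=> A J L; exists 0, 0; split; rewrite ?addr0 //; apply: ideal0.
Qed.
Next Obligation.
move=> A J L _ _ [y [z [Jy Lz ->]]] [y' [z' [Jy' Lz' ->]]].
by exists (y + y'), (z + z'); split; [exact: idealD|exact: idealD|rewrite addrACA].
Qed.
Next Obligation.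
move=> A J L a _ [y [z [Jy Lz ->]]].
by exists (a * y), (a * z); split; [exact: idealMl|exact: idealMl|rewrite mulrDr].
Qed.
Next Obligation.
move=> A J L a _ [y [z [Jy Lz ->]]].
by exists (y * a), (z * a); split; [exact: idealMr|exact: idealMr|rewrite mulrDl].
Qed.

Program Definition ideal_cap (A : ualgType K) (I : Type) (J : I -> ideal A) : ideal A :=
  @Ideal A (fun x => forall i, J i x) _ _ _ _.
Next Obligation. by move=> A I J i; apply: ideal0. Qed.
Next Obligation. by move=> A I J x y Jx Jy i; apply: idealD. Qed.
Next Obligation. by move=> A I J a x Jx i; apply: idealMl. Qed.
Next Obligation. by move=> A I J a x Jx i; apply: idealMr. Qed.

Program Definition kernel (A B : ualgType K) (f : alghom A B) : ideal A :=
  @Ideal A (fun x => f x = 0) _ _ _ _.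
Next Obligation. by move=> A B f; apply: ahom0. Qed.
Next Obligation. by move=> A B f x y fx fy /=; rewrite ahomD fx fy addr0. Qed.
Next Obligation. by move=> A B f a x fx /=; rewrite ahomM fx mulr0. Qed.
Next Obligation. by move=> A B f a x fx /=; rewrite ahomM fx mul0r. Qed.

Section Quotient.
Variables (A : ualgType K) (J : ideal A).

Definition quot_rel (x y : A) := `[< J (x - y) >].

Lemma quot_rel_refl : reflexive quot_rel.
Proof. by move=> x; apply/asboolP; rewrite subrr; apply: ideal0. Qed.
Lemma quot_rel_sym : symmetric quot_rel.
Proof.
suff H x y : quot_rel x y -> quot_rel y x by move=> x y; apply/idP/idP; apply: H.
by move=> /asboolP h; apply/asboolP; rewrite -opprB; apply: idealN.
Qed.
Lemma quot_rel_trans : transitive quot_rel.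
Proof.
move=> y x z /asboolP h /asboolP k; apply/asboolP.
by rewrite -(subrKA y); apply: idealD.
Qed.
Canonical quot_equiv := EquivRel quot_rel quot_rel_refl quot_rel_sym quot_rel_trans.

Definition quot_sort := {eq_quot quot_equiv}%qT.
HB.instance Definition _ := Choice.on quot_sort.

Definition qcls (x : A) : quot_sort := (\pi_{eq_quot quot_equiv}%qT x).
Definition qrep (x : quot_sort) : A := repr x.

Lemma qrepK x : qcls (qrep x) = x. Proof. exact: reprK. Qed.

Lemma qclsP x y : qcls x = qcls y <-> J (x - y).
Proof.
split; first by move=> /eqmodP /asboolP.
by move=> h; apply/eqmodP/asboolP.
Qed.

Lemma qrep_cls x : J (qrep (qcls x) - x).
Proof. by apply/qclsP; rewrite qrepK. Qed.

Lemma quotW (P : quot_sort -> Prop) : (forall x, P (qcls x)) -> forall x, P x.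
Proof. by move=> h x; rewrite -(qrepK x). Qed.

Definition qzero : quot_sort := qcls 0.
Definition qone : quot_sort := qcls 1.
Definition qopp (x : quot_sort) : quot_sort := qcls (- qrep x).
Definition qadd (x y : quot_sort) : quot_sort := qcls (qrep x + qrep y).
Definition qmul (x y : quot_sort) : quot_sort := qcls (qrep x * qrep y).
Definition qscale (a : K) (x : quot_sort) : quot_sort := qcls (a *: qrep x).

Lemma qaddE x y : qadd (qcls x) (qcls y) = qcls (x + y).
Proof. by apply/qclsP; rewrite opprD addrACA; apply: idealD; apply: qrep_cls. Qed.
Lemma qoppE x : qopp (qcls x) = qcls (- x).
Proof. by apply/qclsP; rewrite -opprD; apply: idealN; apply: qrep_cls. Qed.
Lemma qscaleE a x : qscale a (qcls x) = qcls (a *: x).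
Proof. by apply/qclsP; rewrite -scalerBr; apply: idealZ; apply: qrep_cls. Qed.
Lemma qmulE x y : qmul (qcls x) (qcls y) = qcls (x * y).
Proof.
apply/qclsP; rewrite -(subrKA (qrep (qcls x) * y)) -mulrBr -mulrBl.
by apply: idealD; [apply: idealMl|apply: idealMr]; apply: qrep_cls.
Qed.

Lemma qaddA : associative qadd.
Proof.
by elim/quotW=> x; elim/quotW=> y; elim/quotW=> z; rewrite !qaddE addrA.
Qed.
Lemma qaddC : commutative qadd.
Proof. by elim/quotW=> x; elim/quotW=> y; rewrite !qaddE addrC. Qed.
Lemma qadd0 : left_id qzero qadd.
Proof. by elim/quotW=> x; rewrite /qzero qaddE add0r. Qed.
Lemma qaddN : left_inverse qzero qopp qadd.
Proof. by elim/quotW=> x; rewrite qoppE qaddE addNr. Qed.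
HB.instance Definition _ := GRing.isZmodule.Build quot_sort qaddA qaddC qadd0 qaddN.

Lemma qmulA : associative qmul.
Proof.
by elim/quotW=> x; elim/quotW=> y; elim/quotW=> z; rewrite !qmulE mulrA.
Qed.
Lemma qmul1l : left_id qone qmul.
Proof. by elim/quotW=> x; rewrite /qone qmulE mul1r. Qed.
Lemma qmul1r : right_id qone qmul.
Proof. by elim/quotW=> x; rewrite /qone qmulE mulr1. Qed.
Lemma qmulDl : left_distributive qmul qadd.
Proof.
by elim/quotW=> x; elim/quotW=> y; elim/quotW=> z; rewrite !(qaddE, qmulE) mulrDl.
Qed.
Lemma qmulDr : right_distributive qmul qadd.
Proof.
by elim/quotW=> x; elim/quotW=> y; elim/quotW=> z; rewrite !(qaddE, qmulE) mulrDr.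
Qed.
Lemma qscaleA a b x : qscale a (qscale b x) = qscale (a * b) x.
Proof. by elim/quotW: x => x; rewrite !qscaleE scalerA. Qed.
Lemma qscale1 : left_id 1 qscale.
Proof. by elim/quotW=> x; rewrite !qscaleE scale1r. Qed.
Lemma qscaleDr : right_distributive qscale qadd.
Proof.
by move=> a; elim/quotW=> x; elim/quotW=> y; rewrite !(qscaleE, qaddE) scalerDr.
Qed.
Lemma qscaleDl x : {morph qscale^~ x : a b / a + b >-> qadd a b}.
Proof. by move=> a b; elim/quotW: x => x; rewrite !(qscaleE, qaddE) scalerDl. Qed.
HB.instance Definition _ :=
  GRing.Zmodule_isLmodule.Build K quot_sort qscaleA qscale1 qscaleDr qscaleDl.

Lemma quot_scalerAl (a : K) (x y : quot_sort) : a *: qmul x y = qmul (a *: x) y.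
Proof.
elim/quotW: x => x; elim/quotW: y => y.
by rewrite /GRing.scale /= !(qscaleE, qmulE) uscalerAl.
Qed.
Lemma quot_scalerAr (a : K) (x y : quot_sort) : a *: qmul x y = qmul x (a *: y).
Proof.
elim/quotW: x => x; elim/quotW: y => y.
by rewrite /GRing.scale /= !(qscaleE, qmulE) uscalerAr.
Qed.
HB.instance Definition _ := Lmodule_isUAlgebra.Build K quot_sort
  qmulA qmul1l qmul1r qmulDl qmulDr quot_scalerAl quot_scalerAr.

Definition quot : ualgType K := quot_sort.

Lemma qcls_linear : linear (qcls : A -> quot).
Proof. by move=> a x y; rewrite -qaddE -qscaleE. Qed.
Lemma qclsM x y : (qcls (x * y) : quot) = (qcls x : quot) * (qcls y : quot).
Proof. by rewrite -qmulE. Qed.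

Definition qpi : alghom A quot := @AlgHom K A quot qcls qcls_linear erefl qclsM.

End Quotient.

(* The map A/J -> A/L induced by the identity of A, for J included in L. *)
Definition qfactor (A : ualgType K) (J L : ideal A) (x : quot J) : quot L :=
  qpi L (qrep x).

Lemma qfactorE (A : ualgType K) (J L : ideal A) :
  (forall x, J x -> L x) -> forall x, qfactor L (qpi J x) = qpi L x.
Proof. by move=> sJL x; apply/qclsP/sJL/qrep_cls. Qed.

Definition covering (A : ualgType K) (I : finType) (J : I -> ideal A) :=
  forall x, (forall i, J i x) -> x = 0.

Definition complete_covering (A : ualgType K) (I : finType) (J : I -> ideal A) :=
  covering J /\
  forall b : (forall i, quot (J i)),
    (forall i j, qfactor (ideal_add (J i) (J j)) (b i)
               = qfactor (ideal_add (J i) (J j)) (b j)) ->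
    exists x, forall i, qpi (J i) x = b i.

End Ideals.

Section Tensor.
Variable K : fieldType.

Definition bilin (U V W : lmodType K) (f : U -> V -> W) :=
  (forall v, linear (f^~ v)) /\ (forall u, linear (f u)).

Section BilinTheory.
Variables (U V W : lmodType K) (f : U -> V -> W).
Hypothesis fB : bilin f.
Lemma bilinDl u u' v : f (u + u') v = f u v + f u' v.
Proof. by have := fB.1 v 1 u u'; rewrite !scale1r. Qed.
Lemma bilinDr u v v' : f u (v + v') = f u v + f u v'.
Proof. by have := fB.2 u 1 v v'; rewrite !scale1r. Qed.
Lemma bilin0l v : f 0 v = 0.
Proof. by apply: (addrI (f 0 v)); rewrite -bilinDl !addr0. Qed.
Lemma bilin0r u : f u 0 = 0.
Proof. by apply: (addrI (f u 0)); rewrite -bilinDr !addr0. Qed.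
Lemma bilinZl a u v : f (a *: u) v = a *: f u v.
Proof. by have := fB.1 v a u 0; rewrite bilin0l !addr0. Qed.
Lemma bilinZr a u v : f u (a *: v) = a *: f u v.
Proof. by have := fB.2 u a v 0; rewrite bilin0r !addr0. Qed.
End BilinTheory.

Section TensorProduct.
Variables (U V : lmodType K).

Definition formal_sum (W : lmodType K) (f : U -> V -> W) (s : seq (U * V)) : W :=
  \sum_(p <- s) f p.1 p.2.

(* A tensor is a formal sum of pairs (u, v); two formal sums are identified
   when no bilinear map distinguishes them. *)
Definition tens_rel (s t : seq (U * V)) :=
  `[< forall (W : lmodType K) (f : U -> V -> W), bilin f ->
        formal_sum f s = formal_sum f t >].

Lemma tens_rel_refl : reflexive tens_rel.
Proof. by move=> s; apply/asboolP. Qed.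
Lemma tens_rel_sym : symmetric tens_rel.
Proof.
by move=> s t; apply/asboolP/asboolP => h W f fB; rewrite h.
Qed.
Lemma tens_rel_trans : transitive tens_rel.
Proof.
by move=> t s r /asboolP h /asboolP k; apply/asboolP => W f fB; rewrite h // k.
Qed.
Canonical tens_equiv := EquivRel tens_rel tens_rel_refl tens_rel_sym tens_rel_trans.

Definition tensor_sort := {eq_quot tens_equiv}%qT.
HB.instance Definition _ := Choice.on tensor_sort.

Definition tcls (s : seq (U * V)) : tensor_sort := (\pi_{eq_quot tens_equiv}%qT s).
Definition trep (t : tensor_sort) : seq (U * V) := repr t.

Lemma trepK t : tcls (trep t) = t. Proof. exact: reprK. Qed.

Lemma tclsP s t : tcls s = tcls t <->
  (forall (W : lmodType K) (f : U -> V -> W), bilin f ->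
     formal_sum f s = formal_sum f t).
Proof.
split; first by move=> /eqmodP /asboolP.
by move=> h; apply/eqmodP/asboolP.
Qed.

Lemma trep_cls (W : lmodType K) (f : U -> V -> W) s :
  bilin f -> formal_sum f (trep (tcls s)) = formal_sum f s.
Proof. by move=> fB; move: W f fB; apply/tclsP; rewrite trepK. Qed.

Lemma tensW (P : tensor_sort -> Prop) : (forall s, P (tcls s)) -> forall t, P t.
Proof. by move=> h t; rewrite -(trepK t). Qed.

Definition fscale (a : K) (s : seq (U * V)) := [seq (a *: p.1, p.2) | p <- s].

Lemma formal_sum_cat (W : lmodType K) (f : U -> V -> W) s t :
  formal_sum f (s ++ t) = formal_sum f s + formal_sum f t.
Proof. exact: big_cat. Qed.

Lemma formal_sum_scale (W : lmodType K) (f : U -> V -> W) a s :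
  bilin f -> formal_sum f (fscale a s) = a *: formal_sum f s.
Proof.
move=> fB; rewrite /formal_sum big_map scaler_sumr.
by apply: eq_bigr => p _; rewrite (bilinZl fB).
Qed.

Definition tzero : tensor_sort := tcls [::].
Definition tadd (s t : tensor_sort) : tensor_sort := tcls (trep s ++ trep t).
Definition tscale (a : K) (t : tensor_sort) : tensor_sort := tcls (fscale a (trep t)).
Definition topp (t : tensor_sort) : tensor_sort := tscale (-1) t.

Lemma taddE s t : tadd (tcls s) (tcls t) = tcls (s ++ t).
Proof. by apply/tclsP => W f fB; rewrite !formal_sum_cat !trep_cls. Qed.
Lemma tscaleE a s : tscale a (tcls s) = tcls (fscale a s).
Proof. by apply/tclsP => W f fB; rewrite !formal_sum_scale // trep_cls. Qed.

Lemma taddA : associative tadd.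
Proof.
by elim/tensW=> s; elim/tensW=> t; elim/tensW=> r; rewrite !taddE catA.
Qed.
Lemma taddC : commutative tadd.
Proof.
elim/tensW=> s; elim/tensW=> t; rewrite !taddE.
by apply/tclsP => W f fB; rewrite !formal_sum_cat addrC.
Qed.
Lemma tadd0 : left_id tzero tadd.
Proof. by elim/tensW=> s; rewrite taddE. Qed.
Lemma taddN : left_inverse tzero topp tadd.
Proof.
elim/tensW=> s; rewrite /topp tscaleE taddE; apply/tclsP => W f fB.
by rewrite formal_sum_cat formal_sum_scale // scaleN1r addNr /formal_sum big_nil.
Qed.
HB.instance Definition _ := GRing.isZmodule.Build tensor_sort taddA taddC tadd0 taddN.

Lemma tscaleA a b t : tscale a (tscale b t) = tscale (a * b) t.
Proof.
elim/tensW: t => s; rewrite !tscaleE; apply/tclsP => W f fB.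
by rewrite !formal_sum_scale // scalerA.
Qed.
Lemma tscale1 : left_id 1 tscale.
Proof.
elim/tensW=> s; rewrite !tscaleE; apply/tclsP => W f fB.
by rewrite !formal_sum_scale // scale1r.
Qed.
Lemma tscaleDr : right_distributive tscale tadd.
Proof.
move=> a; elim/tensW=> s; elim/tensW=> t; rewrite !(tscaleE, taddE).
by rewrite /fscale map_cat.
Qed.
Lemma tscaleDl t : {morph tscale^~ t : a b / a + b >-> tadd a b}.
Proof.
move=> a b; elim/tensW: t => s; rewrite !(tscaleE, taddE); apply/tclsP => W f fB.
by rewrite formal_sum_cat !formal_sum_scale // scalerDl.
Qed.
HB.instance Definition _ :=
  GRing.Zmodule_isLmodule.Build K tensor_sort tscaleA tscale1 tscaleDr tscaleDl.

Definition tensor : lmodType K := tensor_sort.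

Definition tens (u : U) (v : V) : tensor := tcls [:: (u, v)].

(* The linear map on the tensor product associated with the bilinear map f.
   It is given through a representative, hence meaningful for bilinear f only. *)
Definition tsum (W : lmodType K) (t : tensor) (f : U -> V -> W) : W :=
  formal_sum f (trep t).

Lemma tcls_lin a s t : a *: (tcls s : tensor) + (tcls t : tensor) = tcls (fscale a s ++ t).
Proof. by rewrite /GRing.scale /GRing.add /= tscaleE taddE. Qed.

Lemma tens_bilin : bilin tens.
Proof.
split=> [v a x y|u a x y]; rewrite tcls_lin;
  apply/tclsP => W f fB; rewrite formal_sum_cat formal_sum_scale //.
  by rewrite /formal_sum !big_seq1 (bilinDl fB) (bilinZl fB).
by rewrite /formal_sum !big_seq1 (bilinDr fB) (bilinZr fB).
Qed.

Lemma tsumE (W : lmodType K) (f : U -> V -> W) u v :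
  bilin f -> tsum (tens u v) f = f u v.
Proof. by move=> fB; rewrite /tsum trep_cls // /formal_sum big_seq1. Qed.

Lemma tsum_linear (W : lmodType K) (f : U -> V -> W) :
  bilin f -> linear (fun t => tsum t f).
Proof.
move=> fB a; elim/tensW=> s; elim/tensW=> t.
rewrite tcls_lin.
by rewrite /tsum !trep_cls // formal_sum_cat formal_sum_scale.
Qed.

Lemma tens_sumE (s : seq (U * V)) : (tcls s : tensor) = \sum_(p <- s) tens p.1 p.2.
Proof.
elim: s => [|[u v] s IHs]; first by rewrite big_nil.
by rewrite big_cons -IHs -[tens u v]scale1r tcls_lin /fscale /= scale1r.
Qed.

Lemma tens_ind (P : tensor -> Prop) :
  (forall s t, P s -> P t -> P (s + t)) -> (forall u v, P (tens u v)) ->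
  forall t, P t.
Proof.
move=> PD Pt; elim/tensW=> s; rewrite tens_sumE.
elim: s => [|[u v] s IHs]; last by rewrite big_cons; apply: PD.
by rewrite big_nil -(bilin0l tens_bilin 0); apply: Pt.
Qed.

Lemma tensor_ext (W : lmodType K) (f g : tensor -> W) :
  linear f -> linear g -> (forall u v, f (tens u v) = g (tens u v)) -> f =1 g.
Proof.
move=> fL gL h; elim/tens_ind=> [s t hs ht|u v] //.
by have := fL 1 s t; have := gL 1 s t; rewrite !scale1r hs ht => -> ->.
Qed.

Lemma eq_tsum (W : lmodType K) (f g : U -> V -> W) t :
  (forall u v, f u v = g u v) -> tsum t f = tsum t g.
Proof. by move=> h; apply: eq_bigr => p _. Qed.

End TensorProduct.
End Tensor.

Arguments tens {K U V} u v.

Notation "U ⊗ V" := (tensor U V) (at level 40, left associativity) : type_scope.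
Notation "u ⊗ v" := (tens u v) (at level 40, left associativity) : ring_scope.

(* Sweedler notation: the value on t of the linear extension of
   a ⊗ b |-> E; well defined whenever E is bilinear in (a, b). *)
Notation "\tsum_ ( a , b <- t ) E" := (tsum t (fun a b => E))
  (at level 41, E at level 41, a name, b name,
   format "'[' \tsum_ ( a ,  b  <-  t ) '/  '  E ']'") : ring_scope.

Section TensorMaps.
Variable K : fieldType.

Definition tmap (U V U' V' : lmodType K) (f : U -> U') (g : V -> V')
    (t : (U ⊗ V)%type) : (U' ⊗ V')%type :=
  \tsum_(u, v <- t) f u ⊗ g v.

Definition tassoc (U V W : lmodType K) (t : ((U ⊗ V) ⊗ W)%type) : (U ⊗ (V ⊗ W))%type :=
  \tsum_(p, w <- t) \tsum_(u, v <- p) u ⊗ (v ⊗ w).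

Definition tassocV (U V W : lmodType K) (t : (U ⊗ (V ⊗ W))%type) : ((U ⊗ V) ⊗ W)%type :=
  \tsum_(u, q <- t) \tsum_(v, w <- q) u ⊗ v ⊗ w.

Lemma tmap_bilin (U V U' V' : lmodType K) (f : U -> U') (g : V -> V') :
  linear f -> linear g -> bilin (fun u v => f u ⊗ g v).
Proof.
move=> fL gL; have tB := @tens_bilin K U' V'.
split=> [v a x y|u a x y]; first by rewrite fL (bilinDl tB) (bilinZl tB).
by rewrite gL (bilinDr tB) (bilinZr tB).
Qed.

Lemma tmapE (U V U' V' : lmodType K) (f : U -> U') (g : V -> V') u v :
  linear f -> linear g -> tmap f g (u ⊗ v) = f u ⊗ g v.
Proof. by move=> fL gL; rewrite /tmap tsumE //; apply: tmap_bilin. Qed.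

Lemma tmap_linear (U V U' V' : lmodType K) (f : U -> U') (g : V -> V') :
  linear f -> linear g -> linear (tmap f g).
Proof. by move=> fL gL; apply/tsum_linear/tmap_bilin. Qed.

End TensorMaps.

Section TensorAlgebra.
Variables (K : fieldType) (A B : ualgType K).


Definition talg_mul (s t : (A ⊗ B)%type) : (A ⊗ B)%type :=
  \tsum_(a, b <- s) \tsum_(a', b' <- t) (a * a') ⊗ (b * b').

Let inner_bilin (a : A) (b : B) :
  bilin (fun (a' : A) (b' : B) => (a * a') ⊗ (b * b') : (A ⊗ B)%type).
Proof.
by apply: tmap_bilin => c x y; rewrite mulrDr -uscalerAr.
Qed.

Let outer_bilin (t : (A ⊗ B)%type) :
  bilin (fun (a : A) (b : B) => \tsum_(a', b' <- t) (a * a') ⊗ (b * b') : (A ⊗ B)%type).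
Proof.
have tB := @tens_bilin K A B.
split=> [b c x y|a c x y]; rewrite /tsum /formal_sum scaler_sumr -big_split /=;
  apply: eq_bigr => p _.
  by rewrite mulrDl -uscalerAl (bilinDl tB) (bilinZl tB).
by rewrite mulrDl -uscalerAl (bilinDr tB) (bilinZr tB).
Qed.

Lemma talg_mulE a b a' b' :
  talg_mul (a ⊗ b) (a' ⊗ b') = (a * a') ⊗ (b * b').
Proof. by rewrite /talg_mul (tsumE _ _ (outer_bilin _)) (tsumE _ _ (inner_bilin _ _)). Qed.

Lemma talg_mul_linl t : linear (talg_mul^~ t).
Proof. exact/tsum_linear/outer_bilin. Qed.

Lemma talg_mul_linr s : linear (talg_mul s).
Proof.
move=> c x y; rewrite /talg_mul {1 3 5}/tsum /formal_sum scaler_sumr -big_split /=.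
by apply: eq_bigr => p _; rewrite (tsum_linear (inner_bilin _ _)).
Qed.

Lemma talg_mul_bilin : bilin talg_mul.
Proof. by split; [exact: talg_mul_linl|exact: talg_mul_linr]. Qed.

Lemma talg_mulA : associative talg_mul.
Proof.
have mB := talg_mul_bilin.
elim/tens_ind=> [s s' hs hs' t r|a b]; first by rewrite !(bilinDl mB) hs hs'.
elim/tens_ind=> [t t' ht ht' r|a' b'].
  by rewrite !(bilinDl mB) !(bilinDr mB) !(bilinDl mB) ht ht'.
elim/tens_ind=> [r r' hr hr'|a'' b'']; first by rewrite !(bilinDr mB) hr hr'.
by rewrite !talg_mulE !mulrA.
Qed.
Lemma talg_mul1 : left_id ((1 : A) ⊗ (1 : B)) talg_mul.
Proof.
elim/tens_ind=> [s s' hs hs'|a b]; last by rewrite talg_mulE !mul1r.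
by rewrite (bilinDr talg_mul_bilin) hs hs'.
Qed.
Lemma talg_mulr1 : right_id ((1 : A) ⊗ (1 : B)) talg_mul.
Proof.
elim/tens_ind=> [s s' hs hs'|a b]; last by rewrite talg_mulE !mulr1.
by rewrite (bilinDl talg_mul_bilin) hs hs'.
Qed.
Lemma talg_mulDl : left_distributive talg_mul +%R.
Proof. by move=> x y z; rewrite (bilinDl talg_mul_bilin). Qed.
Lemma talg_mulDr : right_distributive talg_mul +%R.
Proof. by move=> x y z; rewrite (bilinDr talg_mul_bilin). Qed.
Lemma talg_scaleAl (a : K) (x y : (A ⊗ B)%type) : a *: talg_mul x y = talg_mul (a *: x) y.
Proof. by rewrite (bilinZl talg_mul_bilin). Qed.
Lemma talg_scaleAr (a : K) (x y : (A ⊗ B)%type) : a *: talg_mul x y = talg_mul x (a *: y).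
Proof. by rewrite (bilinZr talg_mul_bilin). Qed.
Definition talg_sort : Type := (A ⊗ B)%type.
HB.instance Definition _ := GRing.Lmodule.on talg_sort.
HB.instance Definition _ := Lmodule_isUAlgebra.Build K talg_sort
  talg_mulA talg_mul1 talg_mulr1 talg_mulDl talg_mulDr talg_scaleAl talg_scaleAr.

(* The algebra A ⊗ B, (a ⊗ b)(a' ⊗ b') = aa' ⊗ bb'. *)
Definition talg : ualgType K := talg_sort.

End TensorAlgebra.

Notation "A ⊗alg B" := (talg A B) (at level 40, left associativity) : type_scope.

Section Hopf.
Variable K : fieldType.

Record hopf := Hopf {
  hopf_alg :> ualgType K;
  comul : alghom hopf_alg (hopf_alg ⊗alg hopf_alg);
  counit : hopf_alg -> K;
  antipode : hopf_alg -> hopf_alg;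
  counit_linear : linear (counit : hopf_alg -> K^o);
  counit1 : counit 1 = 1;
  counitM : forall x y, counit (x * y) = counit x * counit y;
  antipode_linear : linear antipode;
  comulA : forall h, tassoc (tmap comul id (comul h)) = tmap id comul (comul h);
  counitl : forall h, \tsum_(h1, h2 <- comul h) counit h1 *: h2 = h;
  counitr : forall h, \tsum_(h1, h2 <- comul h) counit h2 *: h1 = h;
  antipodel : forall h, \tsum_(h1, h2 <- comul h) antipode h1 * h2 = counit h *: (1 : hopf_alg);
  antipoder : forall h, \tsum_(h1, h2 <- comul h) h1 * antipode h2 = counit h *: (1 : hopf_alg)
}.

Definition id_comul (H : hopf) (M : lmodType K) (t : (M ⊗ H)%type) : (M ⊗ H ⊗ H)%type :=
  tassocV (tmap id (comul H) t).

Definition is_coaction (H : hopf) (M : lmodType K) (rho : M -> (M ⊗ H)%type) :=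
  [/\ linear rho,
      forall m, tmap rho id (rho m) = id_comul (rho m)
    & forall m, \tsum_(m0, m1 <- rho m) counit m1 *: m0 = m].

End Hopf.

Section LinearTheory.
Variables (K : fieldType) (U V : lmodType K) (f : U -> V).
Hypothesis fL : linear f.
Lemma linfD x y : f (x + y) = f x + f y.
Proof. by have := fL 1 x y; rewrite !scale1r. Qed.
Lemma linf0 : f 0 = 0.
Proof. by apply: (addrI (f 0)); rewrite -linfD !addr0. Qed.
Lemma linfZ a x : f (a *: x) = a *: f x.
Proof. by have := fL a x 0; rewrite linf0 !addr0. Qed.
Lemma linf_sum I (r : seq I) (P : pred I) F :
  f (\sum_(i <- r | P i) F i) = \sum_(i <- r | P i) f (F i).
Proof. exact: (big_morph f linfD linf0). Qed.
End LinearTheory.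

Section DGA.
Variable K : fieldType.

(* Differential graded algebras.  The grading is encoded by the projections
   [dproj n] onto the homogeneous components. *)
Record dga := Dga {
  dga_alg :> ualgType K;
  dproj : nat -> dga_alg -> dga_alg;
  dd : dga_alg -> dga_alg;
  dproj_linear : forall n, linear (dproj n);
  dd_linear : linear dd;
  dproj_proj : forall m n x, dproj m (dproj n x) = if m == n then dproj n x else 0;
  dproj_sum : forall x, exists N, x = \sum_(n < N) dproj n x;
  dproj1 : dproj 0 1 = 1;
  dprojM : forall m n x y,
    dproj m x = x -> dproj n y = y -> dproj (m + n) (x * y) = x * y;
  dproj_dd : forall n x, dproj n x = x -> dproj n.+1 (dd x) = dd x;
  ddK : forall x, dd (dd x) = 0;
  dd_leibniz : forall n x y, dproj n x = x ->
    dd (x * y) = dd x * y + (-1) ^+ n *: (x * dd y)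
}.

Definition homog (G : dga) (n : nat) (x : G) := dproj n x = x.
Arguments homog : clear implicits.

Record dgahom (G L : dga) := DgaHom {
  dgahom_alg :> alghom G L;
  dgahom_dd : forall x, dgahom_alg (dd x) = dd (dgahom_alg x);
  dgahom_proj : forall n x, dgahom_alg (dproj n x) = dproj n (dgahom_alg x)
}.

Section DGATheory.
Variable G : dga.
Implicit Types x y : G.

Lemma homog_proj n x : homog G n (dproj n x).
Proof. by rewrite /homog dproj_proj eqxx. Qed.

Lemma homogP m n x : homog G n x -> dproj m x = if m == n then x else 0.
Proof. by move=> <-; rewrite dproj_proj. Qed.

Lemma homog0 n : homog G n 0.
Proof. exact: linf0 (dproj_linear n). Qed.

Lemma homogD n x y : homog G n x -> homog G n y -> homog G n (x + y).
Proof. by rewrite /homog (linfD (dproj_linear n)) => -> ->. Qed.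

Lemma homogZ n a x : homog G n x -> homog G n (a *: x).
Proof. by rewrite /homog (linfZ (dproj_linear n)) => ->. Qed.

Definition dbound x : nat := projT1 (cid (dproj_sum x)).
Lemma dboundE x : x = \sum_(n < dbound x) dproj n x.
Proof. by rewrite /dbound; case: cid. Qed.

Lemma dproj_big n x : (dbound x <= n)%N -> dproj n x = 0.
Proof.
move=> le_xn; rewrite (dboundE x) (linf_sum (dproj_linear n)) big1 // => i _.
by rewrite dproj_proj; case: eqP => // ni; move: (ltn_ord i); rewrite -ni ltnNge le_xn.
Qed.

Lemma homog_ind (P : G -> Prop) :
  (forall x y, P x -> P y -> P (x + y)) -> (forall n x, homog G n x -> P x) ->
  forall x, P x.
Proof.
move=> PD Ph x; rewrite (dboundE x); elim/big_ind: _ => //.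
  by apply: (Ph 0); apply: homog0.
by move=> i _; apply: (Ph i); apply: homog_proj.
Qed.

(* The map equal to F n on homogeneous elements of degree n. *)
Definition gext (W : lmodType K) (F : nat -> G -> W) x : W :=
  \sum_(n < dbound x) F n (dproj n x).

Section Gext.
Variables (W : lmodType K) (F : nat -> G -> W).
Hypothesis FL : forall n, linear (F n).

Lemma gext_widen N x : (dbound x <= N)%N -> gext F x = \sum_(n < N) F n (dproj n x).
Proof.
move=> le_xN; rewrite /gext (big_ord_widen N (fun n => F n (dproj n x)) le_xN).
rewrite [RHS](bigID (fun n : 'I_N => (n < dbound x)%N)) /= [X in _ + X]big1 ?addr0 //.
by move=> i; rewrite -leqNgt => /dproj_big ->; rewrite (linf0 (FL i)).
Qed.

Lemma gext_linear : linear (gext F).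
Proof.
move=> a x y; pose N := maxn (dbound (a *: x + y)) (maxn (dbound x) (dbound y)).
rewrite !(gext_widen (N := N)) /N ?leq_max ?leqnn ?orbT //.
rewrite scaler_sumr -big_split; apply: eq_bigr => i _ /=.
by rewrite (dproj_linear i) FL.
Qed.

Lemma gext_homog n x : homog G n x -> gext F x = F n x.
Proof.
move=> hx; rewrite (gext_widen (N := maxn (dbound x) n.+1)) ?leq_maxl //.
have ltn : (n < maxn (dbound x) n.+1)%N by rewrite leq_max leqnn orbT.
rewrite (bigD1 (Ordinal ltn)) //= hx big1 ?addr0 // => i ni.
rewrite (homogP _ hx) ifN ?(linf0 (FL i)) //.
Qed.
End Gext.

Definition dsgn (m : nat) x : G := gext (fun n xn => (-1) ^+ (m * n) *: xn) x.

Lemma scale_linear (a : K) : linear (fun x => a *: x).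
Proof. by move=> b x y; rewrite scalerDr !scalerA mulrC. Qed.

Lemma dsgn_linear m : linear (dsgn m).
Proof. by apply: gext_linear => n; apply: scale_linear. Qed.

Lemma dsgnE m n x : homog G n x -> dsgn m x = (-1) ^+ (m * n) *: x.
Proof. by move=> hx; rewrite /dsgn (gext_homog _ hx) // => k; apply: scale_linear. Qed.

End DGATheory.

Section GradedTensor.
Variables G L : dga.
Local Notation GL := (G ⊗ L)%type.
Local Notation tB := (@tens_bilin K G L).

(* On homogeneous elements, (a ⊗ b)(a' ⊗ b') = (-1)^(|b||a'|) aa' ⊗ bb',
   see gt_mulE. *)
Definition gt_pmul (a : G) (b : L) (a' : G) (b' : L) : GL :=
  gext (fun m bm => (a * dsgn m a') ⊗ (bm * b')) b.

Definition gt_mul (s t : GL) : GL :=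
  \tsum_(a, b <- s) \tsum_(a', b' <- t) gt_pmul a b a' b'.

Definition gt_proj (n : nat) (t : GL) : GL :=
  \tsum_(a, b <- t) \sum_(k < n.+1) dproj k a ⊗ dproj (n - k) b.

Definition gt_d (t : GL) : GL :=
  \tsum_(a, b <- t) (dd a ⊗ b + dsgn 1 a ⊗ dd b).

Let mulr_lin (A : ualgType K) (x : A) : linear (fun y : A => y * x).
Proof. by move=> c y z; rewrite mulrDl uscalerAl. Qed.
Let mull_lin (A : ualgType K) (x : A) : linear (fun y : A => x * y).
Proof. by move=> c y z; rewrite mulrDr uscalerAr. Qed.

Let pmul_core_lin a a' b' m : linear (fun bm : L => (a * dsgn m a') ⊗ (bm * b') : GL).
Proof. by move=> c x y; rewrite mulr_lin (bilinDr tB) (bilinZr tB). Qed.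

Let pmul_bilin_in a b : bilin (gt_pmul a b).
Proof.
split=> [b' c x y|a' c x y]; rewrite /gt_pmul /gext scaler_sumr -big_split;
  apply: eq_bigr => i _ /=.
  by rewrite dsgn_linear mull_lin (bilinDl tB) (bilinZl tB).
by rewrite mull_lin (bilinDr tB) (bilinZr tB).
Qed.

Let pmul_linl b a' b' : linear (fun a => gt_pmul a b a' b').
Proof.
move=> c x y; rewrite /gt_pmul /gext scaler_sumr -big_split; apply: eq_bigr => i _ /=.
by rewrite mulr_lin (bilinDl tB) (bilinZl tB).
Qed.

Let pmul_linr a a' b' : linear (fun b => gt_pmul a b a' b').
Proof. by apply: gext_linear => m; apply: pmul_core_lin. Qed.

Let pmul_bilin_out t :
  bilin (fun (a : G) (b : L) => \tsum_(a', b' <- t) gt_pmul a b a' b').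
Proof.
split=> [b c x y|a c x y]; rewrite /tsum /formal_sum scaler_sumr -big_split;
  by apply: eq_bigr => p _ /=; rewrite ?pmul_linl ?pmul_linr.
Qed.

Lemma gt_mul_bilin : bilin gt_mul.
Proof.
split=> [t|s c x y]; first exact/tsum_linear/pmul_bilin_out.
rewrite /gt_mul {1 3 5}/tsum /formal_sum scaler_sumr -big_split /=.
by apply: eq_bigr => p _; rewrite (tsum_linear (pmul_bilin_in _ _)).
Qed.
Local Notation mB := gt_mul_bilin.

Lemma gt_mulE a b a' b' m n : homog L m b -> homog G n a' ->
  gt_mul (a ⊗ b) (a' ⊗ b') = (-1) ^+ (m * n) *: ((a * a') ⊗ (b * b')).
Proof.
move=> hb ha'; rewrite /gt_mul (tsumE _ _ (pmul_bilin_out _)).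
rewrite (tsumE _ _ (pmul_bilin_in _ _)) /gt_pmul.
rewrite (gext_homog _ hb) ?(dsgnE _ ha'); last by move=> k; apply: pmul_core_lin.
by rewrite -uscalerAr (bilinZl tB).
Qed.

Lemma htens_ind (P : GL -> Prop) :
  (forall s t, P s -> P t -> P (s + t)) ->
  (forall m n a b, homog G m a -> homog L n b -> P (a ⊗ b)) ->
  forall t, P t.
Proof.
move=> PD Pt; apply: tens_ind => // a; move: a.
apply: homog_ind => [x y hx hy b|m a ha]; first by rewrite (bilinDl tB); apply: PD.
apply: homog_ind => [x y hx hy|n b hb]; first by rewrite (bilinDr tB); apply: PD.
exact: Pt ha hb.
Qed.

Let proj_bilin n :
  bilin (fun (a : G) (b : L) => \sum_(k < n.+1) dproj k a ⊗ dproj (n - k) b).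
Proof.
split=> [b c x y|a c x y]; rewrite scaler_sumr -big_split; apply: eq_bigr => i _ /=;
  rewrite dproj_linear.
  by rewrite (bilinDl tB) (bilinZl tB).
by rewrite (bilinDr tB) (bilinZr tB).
Qed.

Lemma gt_proj_linear n : linear (gt_proj n).
Proof. exact/tsum_linear/proj_bilin. Qed.

Lemma gt_projE k m n a b : homog G m a -> homog L n b ->
  gt_proj k (a ⊗ b) = if k == (m + n)%N then a ⊗ b else 0.
Proof.
move=> ha hb; rewrite /gt_proj (tsumE _ _ (proj_bilin _)).
under eq_bigr => i _ do rewrite (homogP _ ha) (homogP _ hb).
case: eqP => [->|ne].
  have ltm : (m < (m + n).+1)%N by rewrite ltnS leq_addr.
  rewrite (bigD1 (Ordinal ltm)) //= eqxx addKn eqxx big1 ?addr0 // => i ni.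
  by rewrite ifN // (bilin0l tB).
rewrite big1 // => i _; case: eqP => [im|]; last by rewrite (bilin0l tB).
case: eqP => [kn|]; last by rewrite (bilin0r tB).
by case: ne; rewrite -kn -im subnKC // -ltnS ltn_ord.
Qed.

Let d_bilin : bilin (fun (a : G) (b : L) => dd a ⊗ b + dsgn 1 a ⊗ dd b).
Proof.
split=> [b c x y|a c x y]; rewrite scalerDr addrACA.
  by rewrite dd_linear dsgn_linear !(bilinDl tB) !(bilinZl tB).
by rewrite dd_linear !(bilinDr tB) !(bilinZr tB).
Qed.

Lemma gt_d_linear : linear gt_d.
Proof. exact/tsum_linear/d_bilin. Qed.

Lemma gt_dE m a b : homog G m a ->
  gt_d (a ⊗ b) = dd a ⊗ b + (-1) ^+ m *: (a ⊗ dd b).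
Proof.
move=> ha; rewrite /gt_d (tsumE _ _ d_bilin) (dsgnE _ ha) mul1n.
by rewrite (bilinZl tB).
Qed.

Lemma gt_mulA : associative gt_mul.
Proof.
elim/htens_ind=> [s s' hs hs' t r|m1 n1 a b ha hb].
  by rewrite !(bilinDl mB) hs hs'.
elim/htens_ind=> [t t' ht ht' r|m2 n2 a' b' ha' hb'].
  by rewrite !(bilinDl mB) !(bilinDr mB) !(bilinDl mB) ht ht'.
elim/htens_ind=> [r r' hr hr'|m3 n3 a'' b'' ha'' hb''].
  by rewrite !(bilinDr mB) hr hr'.
rewrite (gt_mulE _ _ hb' ha'') (gt_mulE _ _ hb ha') (bilinZr mB) (bilinZl mB).
rewrite (gt_mulE _ _ hb (dprojM ha' ha'')) (gt_mulE _ _ (dprojM hb hb') ha'').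
rewrite !scalerA -!exprD !mulrA mulnDr mulnDl; congr (_ ^+ _ *: _); lia.
Qed.

Lemma gt_mul1 : left_id ((1 : G) ⊗ (1 : L)) gt_mul.
Proof.
elim/htens_ind=> [s s' hs hs'|m n a b ha hb]; first by rewrite (bilinDr mB) hs hs'.
by rewrite (gt_mulE _ _ (dproj1 L) ha) mul0n scale1r !mul1r.
Qed.
Lemma gt_mulr1 : right_id ((1 : G) ⊗ (1 : L)) gt_mul.
Proof.
elim/htens_ind=> [s s' hs hs'|m n a b ha hb]; first by rewrite (bilinDl mB) hs hs'.
by rewrite (gt_mulE _ _ hb (dproj1 G)) muln0 scale1r !mulr1.
Qed.
Lemma gt_mulDl : left_distributive gt_mul +%R.
Proof. by move=> x y z; rewrite (bilinDl mB). Qed.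
Lemma gt_mulDr : right_distributive gt_mul +%R.
Proof. by move=> x y z; rewrite (bilinDr mB). Qed.
Lemma gt_scaleAl (a : K) (x y : GL) : a *: gt_mul x y = gt_mul (a *: x) y.
Proof. by rewrite (bilinZl mB). Qed.
Lemma gt_scaleAr (a : K) (x y : GL) : a *: gt_mul x y = gt_mul x (a *: y).
Proof. by rewrite (bilinZr mB). Qed.

Definition gt_sort : Type := GL.
HB.instance Definition _ := GRing.Lmodule.on gt_sort.
HB.instance Definition _ := Lmodule_isUAlgebra.Build K gt_sort
  gt_mulA gt_mul1 gt_mulr1 gt_mulDl gt_mulDr gt_scaleAl gt_scaleAr.
Definition gt_alg : ualgType K := gt_sort.

Lemma gt_algM (x y : gt_alg) : x * y = gt_mul x y.
Proof. by []. Qed.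

Lemma gt_homog_ind k (P : GL -> Prop) :
  P 0 -> (forall s t, P s -> P t -> P (s + t)) ->
  (forall m n a b, homog G m a -> homog L n b -> (m + n)%N = k -> P (a ⊗ b)) ->
  forall t, gt_proj k t = t -> P t.
Proof.
move=> P0 PD Pt t <-; elim/htens_ind: t => [s t hs ht|m n a b ha hb].
  by rewrite (linfD (gt_proj_linear k)); apply: PD.
by rewrite (gt_projE _ ha hb); case: eqP => // kE; apply: Pt ha hb _.
Qed.

Lemma gt_proj_proj m n (x : gt_alg) :
  gt_proj m (gt_proj n x) = if m == n then gt_proj n x else 0.
Proof.
have pL := gt_proj_linear.
elim/htens_ind: x => [s t hs ht|i j a b ha hb].
  by rewrite !(linfD (pL _)) hs ht; case: ifP => // _; rewrite addr0.
rewrite (gt_projE n ha hb); have [->|ne] := eqVneq n (i + j)%N.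
  exact: gt_projE.
by rewrite (linf0 (pL m)) if_same.
Qed.

Lemma gt_proj_sum (x : gt_alg) : exists N, x = \sum_(n < N) gt_proj n x.
Proof.
suff [N /(_ N (leqnn _)) h] : exists N, forall M, (N <= M)%N ->
  x = \sum_(n < M) (gt_proj n x : gt_alg) by exists N.
elim/htens_ind: x => [s t [N hN] [N' hN']|i j a b ha hb].
  exists (maxn N N') => M; rewrite geq_max => /andP[leN leN'].
  rewrite {1}(hN M leN) {1}(hN' M leN') -big_split; apply: eq_bigr => n _ /=.
  by rewrite (linfD (gt_proj_linear n)).
exists (i + j).+1 => M ltM.
rewrite (bigD1 (Ordinal ltM)) //= (gt_projE _ ha hb) eqxx big1 ?addr0 // => n ne.
by rewrite (gt_projE _ ha hb) ifN.
Qed.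

Lemma gt_proj1 : gt_proj 0 (1 : gt_alg) = 1 :> gt_alg.
Proof. exact: (gt_projE 0 (dproj1 G) (dproj1 L)). Qed.

Lemma gt_projM m n (x y : gt_alg) :
  gt_proj m x = x -> gt_proj n y = y -> gt_proj (m + n) (x * y : gt_alg) = x * y :> gt_alg.
Proof.
have pL := gt_proj_linear (m + n).
move=> hx hy; elim/gt_homog_ind: hx => [|s t hs ht|i j a b ha hb ijE].
- by rewrite mul0r (linf0 pL).
- by rewrite mulrDl (linfD pL) hs ht.
elim/gt_homog_ind: hy => [|s t hs ht|i' j' a' b' ha' hb' ijE'].
- by rewrite mulr0 (linf0 pL).
- by rewrite mulrDr (linfD pL) hs ht.
rewrite [_ * _](gt_mulE a b' hb ha') (linfZ pL).
rewrite (gt_projE _ (dprojM ha ha') (dprojM hb hb')).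
by rewrite addnACA ijE ijE' eqxx.
Qed.

Lemma gt_proj_d n (x : gt_alg) : gt_proj n x = x -> gt_proj n.+1 (gt_d x) = gt_d x.
Proof.
have pL := gt_proj_linear n.+1; have dL := gt_d_linear.
move=> hx; elim/gt_homog_ind: hx => [|s t hs ht|i j a b ha hb ijE].
- by rewrite (linf0 dL) (linf0 pL).
- by rewrite (linfD dL) (linfD pL) hs ht.
rewrite (gt_dE b ha) (linfD pL) (linfZ pL).
rewrite (gt_projE _ (dproj_dd ha) hb) (gt_projE _ ha (dproj_dd hb)).
by rewrite addSn addnS ijE eqxx.
Qed.

Lemma gt_dK (x : gt_alg) : gt_d (gt_d x) = 0.
Proof.
have dL := gt_d_linear.
elim/htens_ind: x => [s t hs ht|i j a b ha hb]; first by rewrite !(linfD dL) hs ht addr0.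
rewrite (gt_dE b ha) (linfD dL) (linfZ dL) (gt_dE _ (dproj_dd ha)) (gt_dE _ ha).
rewrite !ddK (bilin0l tB) (bilin0r tB) scaler0 add0r addr0.
by rewrite exprS mulN1r scaleNr addNr.
Qed.

Lemma gt_leibniz n (x y : gt_alg) : gt_proj n x = x ->
  gt_d (x * y : gt_alg) = (gt_d x : gt_alg) * y + (-1) ^+ n *: (x * (gt_d y : gt_alg)) :> gt_alg.
Proof.
have dL := gt_d_linear.
move=> hx; elim/gt_homog_ind: hx => [|s t hs ht|i j a b ha hb ijE].
- by rewrite !mul0r (linf0 dL) mul0r scaler0 addr0.
- by rewrite !mulrDl !(linfD dL) mulrDl hs ht scalerDr addrACA.
elim/htens_ind: y => [s t hs ht|k l a' b' ha' hb'].
  by rewrite !mulrDr !(linfD dL) mulrDr hs ht scalerDr addrACA.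
rewrite !gt_algM (gt_mulE _ _ hb ha') (linfZ dL) (gt_dE _ (dprojM ha ha')).
rewrite (dd_leibniz _ ha) (dd_leibniz _ hb) (gt_dE b ha) (gt_dE b' ha').
rewrite (bilinDl mB) !(bilinDr mB) (bilinZl mB) (bilinZr mB).
rewrite (gt_mulE _ _ hb ha') (gt_mulE _ _ (dproj_dd hb) ha').
rewrite (gt_mulE _ _ hb (dproj_dd ha')) (gt_mulE _ _ hb ha').
rewrite !(bilinDl tB) !(bilinDr tB) !(bilinZl tB) !(bilinZr tB).
rewrite !scalerDr !scalerA -!exprD -ijE.
rewrite [LHS]addrACA; congr (_ + _ + (_ + _)); congr (_ *: _).
- by congr (_ ^+ _); lia.
- have -> : (i + j + j * k.+1 = j * k + i + 2 * j)%N by lia.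
  by rewrite [RHS]exprD exprM sqrrN expr1n expr1n mulr1.
- by congr (_ ^+ _); lia.
Qed.

Definition gtens : dga :=
  @Dga gt_alg gt_proj gt_d gt_proj_linear gt_d_linear gt_proj_proj gt_proj_sum
    gt_proj1 gt_projM gt_proj_d gt_dK gt_leibniz.

End GradedTensor.
End DGA.

Arguments homog {K} G n x.

Section Subalgebras.
Variable K : fieldType.

Record subalgebra (A : ualgType K) := Subalgebra {
  subalg_mem :> A -> Prop;
  subalg1 : subalg_mem 1;
  subalg_lin : forall a x y, subalg_mem x -> subalg_mem y -> subalg_mem (a *: x + y);
  subalgM : forall x y, subalg_mem x -> subalg_mem y -> subalg_mem (x * y)
}.

Section SubalgType.
Variables (A : ualgType K) (S : subalgebra A).

Lemma subalg0 : S 0.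
Proof. by rewrite -(addNr 1) -scaleN1r; apply: subalg_lin; apply: subalg1. Qed.
Lemma subalgZ a x : S x -> S (a *: x).
Proof. by move=> Sx; rewrite -[_ *: _]addr0; apply: subalg_lin => //; apply: subalg0. Qed.
Lemma subalgD x y : S x -> S y -> S (x + y).
Proof. by move=> Sx Sy; rewrite -[x]scale1r; apply: subalg_lin. Qed.
Lemma subalgN x : S x -> S (- x).
Proof. by move=> Sx; rewrite -scaleN1r; apply: subalgZ. Qed.

Record subalg_sort := SubalgElt { subalg_elt : A; subalg_eltP : S subalg_elt }.

Lemma subalg_elt_inj : injective subalg_elt.
Proof.
by case=> x Sx [y Sy] /= xy; case: y / xy Sy => Sx'; rewrite (Prop_irrelevance Sx Sx').
Qed.

HB.instance Definition _ := gen_eqMixin subalg_sort.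
HB.instance Definition _ := gen_choiceMixin subalg_sort.

Definition sa_zero := SubalgElt subalg0.
Definition sa_one := SubalgElt (subalg1 S).
Definition sa_add (x y : subalg_sort) := SubalgElt (subalgD (subalg_eltP x) (subalg_eltP y)).
Definition sa_opp (x : subalg_sort) := SubalgElt (subalgN (subalg_eltP x)).
Definition sa_scale a (x : subalg_sort) := SubalgElt (subalgZ a (subalg_eltP x)).
Definition sa_mul (x y : subalg_sort) := SubalgElt (subalgM (subalg_eltP x) (subalg_eltP y)).

Lemma sa_addA : associative sa_add.
Proof. by move=> x y z; apply/subalg_elt_inj/addrA. Qed.
Lemma sa_addC : commutative sa_add.
Proof. by move=> x y; apply/subalg_elt_inj/addrC. Qed.
Lemma sa_add0 : left_id sa_zero sa_add.
Proof. by move=> x; apply/subalg_elt_inj/add0r. Qed.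
Lemma sa_addN : left_inverse sa_zero sa_opp sa_add.
Proof. by move=> x; apply/subalg_elt_inj/addNr. Qed.
HB.instance Definition _ := GRing.isZmodule.Build subalg_sort sa_addA sa_addC sa_add0 sa_addN.

Lemma sa_scaleA a b x : sa_scale a (sa_scale b x) = sa_scale (a * b) x.
Proof. by apply/subalg_elt_inj/scalerA. Qed.
Lemma sa_scale1 : left_id 1 sa_scale.
Proof. by move=> x; apply/subalg_elt_inj/scale1r. Qed.
Lemma sa_scaleDr : right_distributive sa_scale sa_add.
Proof. by move=> a x y; apply/subalg_elt_inj/scalerDr. Qed.
Lemma sa_scaleDl x : {morph sa_scale^~ x : a b / a + b >-> sa_add a b}.
Proof. by move=> a b; apply/subalg_elt_inj/scalerDl. Qed.
HB.instance Definition _ :=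
  GRing.Zmodule_isLmodule.Build K subalg_sort sa_scaleA sa_scale1 sa_scaleDr sa_scaleDl.

Lemma sa_mulA : associative sa_mul.
Proof. by move=> x y z; apply/subalg_elt_inj/mulrA. Qed.
Lemma sa_mul1 : left_id sa_one sa_mul.
Proof. by move=> x; apply/subalg_elt_inj/mul1r. Qed.
Lemma sa_mulr1 : right_id sa_one sa_mul.
Proof. by move=> x; apply/subalg_elt_inj/mulr1. Qed.
Lemma sa_mulDl : left_distributive sa_mul +%R.
Proof. by move=> x y z; apply/subalg_elt_inj/mulrDl. Qed.
Lemma sa_mulDr : right_distributive sa_mul +%R.
Proof. by move=> x y z; apply/subalg_elt_inj/mulrDr. Qed.
Lemma sa_scaleAl (a : K) (x y : subalg_sort) : a *: sa_mul x y = sa_mul (a *: x) y.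
Proof. by apply/subalg_elt_inj/uscalerAl. Qed.
Lemma sa_scaleAr (a : K) (x y : subalg_sort) : a *: sa_mul x y = sa_mul x (a *: y).
Proof. by apply/subalg_elt_inj/uscalerAr. Qed.
HB.instance Definition _ := Lmodule_isUAlgebra.Build K subalg_sort
  sa_mulA sa_mul1 sa_mulr1 sa_mulDl sa_mulDr sa_scaleAl sa_scaleAr.

Definition subalg : ualgType K := subalg_sort.

Lemma sa_val_linear : linear (subalg_elt : subalg -> A).
Proof. by []. Qed.

Definition sa_val : alghom subalg A :=
  @AlgHom K subalg A subalg_elt sa_val_linear erefl (fun _ _ => erefl).

Definition sa_in (x : A) (Sx : S x) : subalg := SubalgElt Sx.

End SubalgType.
End Subalgebras.

Section ProductAlgebra.
Variables (K : fieldType) (I : Type) (T : I -> ualgType K).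

Definition prodalg_sort := forall i, T i.
HB.instance Definition _ := gen_eqMixin prodalg_sort.
HB.instance Definition _ := gen_choiceMixin prodalg_sort.

Let ext (x y : prodalg_sort) : (forall i, x i = y i) -> x = y.
Proof. exact: functional_extensionality_dep. Qed.

Definition pr_zero : prodalg_sort := fun=> 0.
Definition pr_one : prodalg_sort := fun=> 1.
Definition pr_add (x y : prodalg_sort) : prodalg_sort := fun i => x i + y i.
Definition pr_opp (x : prodalg_sort) : prodalg_sort := fun i => - x i.
Definition pr_scale a (x : prodalg_sort) : prodalg_sort := fun i => a *: x i.
Definition pr_mul (x y : prodalg_sort) : prodalg_sort := fun i => x i * y i.

Lemma pr_addA : associative pr_add.
Proof. by move=> x y z; apply: ext => i; apply: addrA. Qed.
Lemma pr_addC : commutative pr_add.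
Proof. by move=> x y; apply: ext => i; apply: addrC. Qed.
Lemma pr_add0 : left_id pr_zero pr_add.
Proof. by move=> x; apply: ext => i; apply: add0r. Qed.
Lemma pr_addN : left_inverse pr_zero pr_opp pr_add.
Proof. by move=> x; apply: ext => i; apply: addNr. Qed.
HB.instance Definition _ := GRing.isZmodule.Build prodalg_sort pr_addA pr_addC pr_add0 pr_addN.

Lemma pr_scaleA a b x : pr_scale a (pr_scale b x) = pr_scale (a * b) x.
Proof. by apply: ext => i; apply: scalerA. Qed.
Lemma pr_scale1 : left_id 1 pr_scale.
Proof. by move=> x; apply: ext => i; apply: scale1r. Qed.
Lemma pr_scaleDr : right_distributive pr_scale pr_add.
Proof. by move=> a x y; apply: ext => i; apply: scalerDr. Qed.
Lemma pr_scaleDl x : {morph pr_scale^~ x : a b / a + b >-> pr_add a b}.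
Proof. by move=> a b; apply: ext => i; apply: scalerDl. Qed.
HB.instance Definition _ :=
  GRing.Zmodule_isLmodule.Build K prodalg_sort pr_scaleA pr_scale1 pr_scaleDr pr_scaleDl.

Lemma pr_mulA : associative pr_mul.
Proof. by move=> x y z; apply: ext => i; apply: mulrA. Qed.
Lemma pr_mul1 : left_id pr_one pr_mul.
Proof. by move=> x; apply: ext => i; apply: mul1r. Qed.
Lemma pr_mulr1 : right_id pr_one pr_mul.
Proof. by move=> x; apply: ext => i; apply: mulr1. Qed.
Lemma pr_mulDl : left_distributive pr_mul +%R.
Proof. by move=> x y z; apply: ext => i; apply: mulrDl. Qed.
Lemma pr_mulDr : right_distributive pr_mul +%R.
Proof. by move=> x y z; apply: ext => i; apply: mulrDr. Qed.
Lemma pr_scaleAl (a : K) (x y : prodalg_sort) : a *: pr_mul x y = pr_mul (a *: x) y.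
Proof. by apply: ext => i; apply: uscalerAl. Qed.
Lemma pr_scaleAr (a : K) (x y : prodalg_sort) : a *: pr_mul x y = pr_mul x (a *: y).
Proof. by apply: ext => i; apply: uscalerAr. Qed.
HB.instance Definition _ := Lmodule_isUAlgebra.Build K prodalg_sort
  pr_mulA pr_mul1 pr_mulr1 pr_mulDl pr_mulDr pr_scaleAl pr_scaleAr.

Definition prodalg : ualgType K := prodalg_sort.

Lemma pr_proj_linear i : linear ((fun x => x i) : prodalg -> T i).
Proof. by []. Qed.

Definition pr_proj i : alghom prodalg (T i) :=
  @AlgHom K prodalg (T i) (fun x => x i) (@pr_proj_linear i) erefl (fun _ _ => erefl).

End ProductAlgebra.

Section DifferentialAlgebras.
Variable K : fieldType.

Record diffalg (A : ualgType K) := DiffAlg {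
  da_dga :> dga K;
  da_inc : alghom A da_dga;
  da_inc_inj : injective da_inc;
  da_degree0 : forall x, homog da_dga 0 x <-> exists a, x = da_inc a;
  da_generated : forall S : subalgebra da_dga,
    (forall a, S (da_inc a)) -> (forall a, S (dd (da_inc a))) -> forall x, S x
}.

(* Right covariance: the comultiplication extends to an algebra homomorphism
   Γ(H) -> Γ(H) ⊗ H intertwining d with d ⊗ id. *)
Definition right_covariant (H : hopf K) (G : diffalg H) :=
  exists delta : alghom G (G ⊗alg H),
    (forall h, delta (da_inc G h) = tmap (da_inc G) id (comul H h)) /\
    (forall x, delta (dd x) = tmap (@dd K G) id (delta x)).

End DifferentialAlgebras.

Section DGAFacts.
Variables (K : fieldType) (G : dga K).
Lemma dd1 : dd (1 : G) = 0.
Proof.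
have := dd_leibniz (1 : G) (dproj1 G).
by rewrite !mulr1 mul1r scale1r => /(congr1 (+%R^~ (- dd (1 : G)))); rewrite addrK subrr.
Qed.
End DGAFacts.

Section UniversalDGA.
Variables (K : fieldType) (A : ualgType K).

(* Noncommutative words in the letters a (inl a) and da (inr a), a in A. *)
Local Notation word := (seq (A + A)).
Local Notation poly := (seq word).

Section Evaluation.
Variables (G : dga K) (phi : alghom A G).

Definition ev_letter (l : A + A) : G :=
  match l with inl a => phi a | inr a => dd (phi a) end.
Definition ev_word (w : word) : G := \prod_(l <- w) ev_letter l.
Definition ev_poly (s : poly) : G := \sum_(w <- s) ev_word w.

End Evaluation.

Definition isdiff (l : A + A) : bool := if l is inr _ then true else false.
Definition wdeg (w : word) : nat := count isdiff w.

Definition pl_scale (c : K) (s : poly) : poly := [seq inl (c *: (1 : A)) :: w | w <- s].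
Definition pl_mul (s t : poly) : poly := [seq w ++ v | w <- s, v <- t].
Definition pl_proj (n : nat) (s : poly) : poly := [seq w <- s | wdeg w == n].
Fixpoint wd (w : word) : poly :=
  match w with
  | [::] => [::]
  | inl a :: w' => (inr a :: w') :: [seq inl a :: v | v <- wd w']
  | inr a :: w' => pl_scale (-1) [seq inr a :: v | v <- wd w']
  end.
Definition pl_d (s : poly) : poly := flatten [seq wd w | w <- s].

Section EvaluationTheory.
Variables (G : dga K) (phi : alghom A G).
Hypothesis phi0 : forall a, homog G 0 (phi a).
Local Notation ev := (ev_poly phi).
Local Notation evw := (ev_word phi).

Lemma ev_nil : ev [::] = 0. Proof. by rewrite /ev_poly big_nil. Qed.
Lemma ev_cat s t : ev (s ++ t) = ev s + ev t.
Proof. by rewrite /ev_poly big_cat. Qed.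
Lemma ev_one : ev [:: [::]] = 1.
Proof. by rewrite /ev_poly big_seq1 /ev_word big_nil. Qed.
Lemma ev_letterS l s : ev [seq l :: w | w <- s] = ev_letter phi l * ev s.
Proof.
rewrite /ev_poly big_map mulr_sumr; apply: eq_bigr => w _.
by rewrite /ev_word big_cons.
Qed.
Lemma ev_scale c s : ev (pl_scale c s) = c *: ev s.
Proof. by rewrite ev_letterS /= ahomZ ahom1 -uscalerAl mul1r. Qed.
Lemma ev_mul s t : ev (pl_mul s t) = ev s * ev t.
Proof.
rewrite /ev_poly /pl_mul big_allpairs_dep mulr_suml; apply: eq_bigr => w _.
by rewrite mulr_sumr; apply: eq_bigr => v _; rewrite /ev_word big_cat.
Qed.

Lemma ev_wordP w : homog G (wdeg w) (evw w).
Proof.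
elim: w => [|l w IHw]; first by rewrite /ev_word big_nil; apply: dproj1.
rewrite /ev_word big_cons; apply: (@dprojM _ G (isdiff l) (wdeg w)) => //.
by case: l => a /=; [apply: phi0|apply: dproj_dd; apply: phi0].
Qed.

Lemma ev_wd w : ev (wd w) = dd (evw w).
Proof.
elim: w => [|[a|a] w IHw] /=; first by rewrite ev_nil /ev_word big_nil dd1.
  rewrite [LHS](ev_cat [:: _]) ev_letterS IHw [evw (_ :: _)]big_cons.
  rewrite (dd_leibniz _ (phi0 a)) scale1r; congr (_ + _).
  by rewrite /ev_poly big_seq1 [LHS]big_cons.
rewrite ev_scale ev_letterS IHw [evw (_ :: _)]big_cons.
by rewrite (dd_leibniz _ (dproj_dd (phi0 a))) ddK mul0r add0r expr1.
Qed.

Lemma ev_d s : ev (pl_d s) = dd (ev s).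
Proof.
elim: s => [|w s IHs]; first by rewrite ev_nil (linf0 (@dd_linear _ G)).
by rewrite /pl_d /= ev_cat IHs ev_wd /ev_poly big_cons (linfD (@dd_linear _ G)).
Qed.

Lemma ev_proj n s : ev (pl_proj n s) = dproj n (ev s).
Proof.
rewrite /ev_poly (linf_sum (dproj_linear n)) big_filter big_mkcond.
by apply: eq_bigr => w _; rewrite (homogP _ (ev_wordP w)) eq_sym.
Qed.
End EvaluationTheory.

(* The universal differential algebra Ω(A): noncommutative polynomials in the
   letters a and da, identified when no algebra homomorphism from A to the
   degree 0 part of a differential graded algebra distinguishes them. *)
Definition om_rel (s t : poly) :=
  `[< forall (G : dga K) (phi : alghom A G), (forall a, homog G 0 (phi a)) ->
        ev_poly phi s = ev_poly phi t >].

Lemma om_rel_refl : reflexive om_rel.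
Proof. by move=> s; apply/asboolP. Qed.
Lemma om_rel_sym : symmetric om_rel.
Proof. by move=> s t; apply/asboolP/asboolP => h G phi phi0; rewrite h. Qed.
Lemma om_rel_trans : transitive om_rel.
Proof.
by move=> t s r /asboolP h /asboolP k; apply/asboolP => G phi phi0; rewrite h // k.
Qed.
Canonical om_equiv := EquivRel om_rel om_rel_refl om_rel_sym om_rel_trans.

Definition om_sort := {eq_quot om_equiv}%qT.
HB.instance Definition _ := Choice.on om_sort.

Definition omcls (s : poly) : om_sort := (\pi_{eq_quot om_equiv}%qT s).
Definition omrep (x : om_sort) : poly := repr x.

Definition om_ev (G : dga K) (phi : alghom A G) (x : om_sort) : G := ev_poly phi (omrep x).

Lemma om_ext x y :
  (forall (G : dga K) (phi : alghom A G), (forall a, homog G 0 (phi a)) ->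
     om_ev phi x = om_ev phi y) -> x = y.
Proof.
move=> h; rewrite -[x]reprK -[y]reprK; apply/eqmodP/asboolP => G phi phi0.
exact: h.
Qed.

Lemma om_evE (G : dga K) (phi : alghom A G) s :
  (forall a, homog G 0 (phi a)) -> om_ev phi (omcls s) = ev_poly phi s.
Proof.
have /eqmodP/asboolP h : (omcls (omrep (omcls s)) = omcls s) by exact: reprK.
by move=> phi0; apply: h.
Qed.

Definition om_zero : om_sort := omcls [::].
Definition om_one : om_sort := omcls [:: [::]].
Definition om_add (x y : om_sort) : om_sort := omcls (omrep x ++ omrep y).
Definition om_scale c (x : om_sort) : om_sort := omcls (pl_scale c (omrep x)).
Definition om_opp (x : om_sort) : om_sort := om_scale (-1) x.
Definition om_mul (x y : om_sort) : om_sort := omcls (pl_mul (omrep x) (omrep y)).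
Definition om_proj n (x : om_sort) : om_sort := omcls (pl_proj n (omrep x)).
Definition om_d (x : om_sort) : om_sort := omcls (pl_d (omrep x)).

Section OmEv.
Variables (G : dga K) (phi : alghom A G).
Hypothesis phi0 : forall a, homog G 0 (phi a).
Lemma om_ev0 : om_ev phi om_zero = 0.
Proof. by rewrite om_evE // ev_nil. Qed.
Lemma om_ev1 : om_ev phi om_one = 1.
Proof. by rewrite om_evE // ev_one. Qed.
Lemma om_evD x y : om_ev phi (om_add x y) = om_ev phi x + om_ev phi y.
Proof. by rewrite om_evE // ev_cat. Qed.
Lemma om_evZ c x : om_ev phi (om_scale c x) = c *: om_ev phi x.
Proof. by rewrite om_evE // ev_scale. Qed.
Lemma om_evN x : om_ev phi (om_opp x) = - om_ev phi x.
Proof. by rewrite om_evZ scaleN1r. Qed.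
Lemma om_evM x y : om_ev phi (om_mul x y) = om_ev phi x * om_ev phi y.
Proof. by rewrite om_evE // ev_mul. Qed.
Lemma om_ev_proj n x : om_ev phi (om_proj n x) = dproj n (om_ev phi x).
Proof. by rewrite om_evE // ev_proj. Qed.
Lemma om_ev_d x : om_ev phi (om_d x) = dd (om_ev phi x).
Proof. by rewrite om_evE // ev_d. Qed.
Definition om_evs := (om_ev0, om_ev1, om_evD, om_evZ, om_evN, om_evM, om_ev_proj, om_ev_d).
End OmEv.

Lemma om_addA : associative om_add.
Proof. by move=> x y z; apply: om_ext => G phi phi0; rewrite !om_evs // addrA. Qed.
Lemma om_addC : commutative om_add.
Proof. by move=> x y; apply: om_ext => G phi phi0; rewrite !om_evs // addrC. Qed.
Lemma om_add0 : left_id om_zero om_add.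
Proof. by move=> x; apply: om_ext => G phi phi0; rewrite !om_evs // add0r. Qed.
Lemma om_addN : left_inverse om_zero om_opp om_add.
Proof. by move=> x; apply: om_ext => G phi phi0; rewrite !om_evs // addNr. Qed.
HB.instance Definition _ := GRing.isZmodule.Build om_sort om_addA om_addC om_add0 om_addN.

Lemma om_scaleA a b x : om_scale a (om_scale b x) = om_scale (a * b) x.
Proof. by apply: om_ext => G phi phi0; rewrite !om_evs // scalerA. Qed.
Lemma om_scale1 : left_id 1 om_scale.
Proof. by move=> x; apply: om_ext => G phi phi0; rewrite !om_evs // scale1r. Qed.
Lemma om_scaleDr : right_distributive om_scale om_add.
Proof. by move=> a x y; apply: om_ext => G phi phi0; rewrite !om_evs // scalerDr. Qed.
Lemma om_scaleDl x : {morph om_scale^~ x : a b / a + b >-> om_add a b}.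
Proof. by move=> a b; apply: om_ext => G phi phi0; rewrite !om_evs // scalerDl. Qed.
HB.instance Definition _ :=
  GRing.Zmodule_isLmodule.Build K om_sort om_scaleA om_scale1 om_scaleDr om_scaleDl.

Lemma om_mulA : associative om_mul.
Proof. by move=> x y z; apply: om_ext => G phi phi0; rewrite !om_evs // mulrA. Qed.
Lemma om_mul1 : left_id om_one om_mul.
Proof. by move=> x; apply: om_ext => G phi phi0; rewrite !om_evs // mul1r. Qed.
Lemma om_mulr1 : right_id om_one om_mul.
Proof. by move=> x; apply: om_ext => G phi phi0; rewrite !om_evs // mulr1. Qed.
Lemma om_mulDl : left_distributive om_mul +%R.
Proof. by move=> x y z; apply: om_ext => G phi phi0; rewrite !om_evs // mulrDl. Qed.
Lemma om_mulDr : right_distributive om_mul +%R.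
Proof. by move=> x y z; apply: om_ext => G phi phi0; rewrite !om_evs // mulrDr. Qed.
Lemma om_scaleAl (a : K) (x y : om_sort) : a *: om_mul x y = om_mul (a *: x) y.
Proof. by apply: om_ext => G phi phi0; rewrite !om_evs // uscalerAl. Qed.
Lemma om_scaleAr (a : K) (x y : om_sort) : a *: om_mul x y = om_mul x (a *: y).
Proof. by apply: om_ext => G phi phi0; rewrite !om_evs // uscalerAr. Qed.
HB.instance Definition _ := Lmodule_isUAlgebra.Build K om_sort
  om_mulA om_mul1 om_mulr1 om_mulDl om_mulDr om_scaleAl om_scaleAr.

Definition om_alg : ualgType K := om_sort.

Section OmEvAlg.
Variables (G : dga K) (phi : alghom A G).
Hypothesis phi0 : forall a, homog G 0 (phi a).
Lemma om_ev_linear : linear (om_ev phi : om_alg -> G).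
Proof. by move=> a x y; rewrite [LHS](om_evD phi0) [om_ev _ (_ *: _)](om_evZ phi0). Qed.
Lemma om_evaM (x y : om_alg) : om_ev phi (x * y : om_alg) = om_ev phi x * om_ev phi y.
Proof. exact: om_evM. Qed.
Definition om_evh : alghom om_alg G :=
  @AlgHom K om_alg G (om_ev phi) om_ev_linear (om_ev1 phi0) om_evaM.
End OmEvAlg.

Lemma om_proj_linear n : linear (om_proj n : om_alg -> om_alg).
Proof.
move=> a x y; apply: om_ext => G phi phi0.
by rewrite om_ev_proj // !(om_ev_linear phi0) !om_ev_proj // dproj_linear.
Qed.
Lemma om_d_linear : linear (om_d : om_alg -> om_alg).
Proof.
move=> a x y; apply: om_ext => G phi phi0.
by rewrite om_ev_d // !(om_ev_linear phi0) !om_ev_d // dd_linear.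
Qed.
Lemma om_proj_proj m n (x : om_alg) :
  om_proj m (om_proj n x) = if m == n then om_proj n x else 0 :> om_alg.
Proof.
apply: om_ext => G phi phi0; rewrite !om_ev_proj // dproj_proj.
by case: ifP => _; rewrite ?om_ev_proj // [RHS](om_ev0 phi0).
Qed.
Lemma om_proj_sum (x : om_alg) : exists N, x = \sum_(n < N) om_proj n x.
Proof.
pose N := (\max_(w <- omrep x) wdeg w).+1; exists N.
apply: om_ext => G phi phi0.
rewrite (linf_sum (om_ev_linear phi0)).
under eq_bigr => n _ do rewrite om_ev_proj //.
rewrite /om_ev /ev_poly.
under [RHS]eq_bigr => n _ do rewrite (linf_sum (dproj_linear n)).
rewrite exchange_big big_seq_cond [RHS]big_seq_cond; apply: eq_bigr => w /andP[wx _].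
have ltw : (wdeg w < N)%N by rewrite ltnS; apply: leq_bigmax_seq.
rewrite (bigD1 (Ordinal ltw)) //= (ev_wordP phi0) big1 ?addr0 // => i ni.
by rewrite (homogP _ (ev_wordP phi0 w)) ifN.
Qed.
Lemma om_proj1 : om_proj 0 (1 : om_alg) = 1 :> om_alg.
Proof.
by apply: om_ext => G phi phi0; rewrite om_ev_proj // [om_ev _ _](om_ev1 phi0) dproj1.
Qed.
Lemma om_projM m n (x y : om_alg) :
  om_proj m x = x -> om_proj n y = y ->
  om_proj (m + n) (x * y : om_alg) = x * y :> om_alg.
Proof.
move=> hx hy; apply: om_ext => G phi phi0.
rewrite om_ev_proj // !om_evaM // dprojM // -om_ev_proj //; [by rewrite hx|by rewrite hy].
Qed.
Lemma om_proj_d n (x : om_alg) : om_proj n x = x -> om_proj n.+1 (om_d x) = om_d x.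
Proof.
move=> hx; apply: om_ext => G phi phi0.
by rewrite om_ev_proj // om_ev_d // dproj_dd // -om_ev_proj // hx.
Qed.
Lemma om_dK (x : om_alg) : om_d (om_d x) = 0 :> om_alg.
Proof.
by apply: om_ext => G phi phi0; rewrite !om_ev_d // ddK [RHS](om_ev0 phi0).
Qed.
Lemma om_leibniz n (x y : om_alg) : om_proj n x = x ->
  om_d (x * y : om_alg)
    = (om_d x : om_alg) * y + (-1) ^+ n *: (x * (om_d y : om_alg)) :> om_alg.
Proof.
move=> hx; apply: om_ext => G phi phi0.
rewrite addrC om_ev_linear // om_ev_d // !om_evaM // !om_ev_d //.
by rewrite (@dd_leibniz _ _ n) 1?addrC // -om_ev_proj // hx.
Qed.

Definition om_dga : dga K :=
  @Dga K om_alg om_proj om_d om_proj_linear om_d_linear om_proj_proj om_proj_sum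
    om_proj1 om_projM om_proj_d om_dK om_leibniz.

Lemma om_inc_linear : linear ((fun a => omcls [:: [:: inl a]]) : A -> om_alg).
Proof.
move=> c a b; apply: om_ext => G phi phi0.
rewrite om_ev_linear // !om_evE // /ev_poly !big_seq1 /ev_word !big_seq1 /=.
exact: ahom_linear.
Qed.
Lemma om_inc1 : omcls [:: [:: inl 1]] = 1 :> om_alg.
Proof.
apply: om_ext => G phi phi0; rewrite [RHS](om_ev1 phi0) om_evE // /ev_poly big_seq1.
by rewrite /ev_word big_seq1 /= ahom1.
Qed.
Lemma om_incM a b :
  omcls [:: [:: inl (a * b)]]
    = (omcls [:: [:: inl a]] : om_alg) * (omcls [:: [:: inl b]] : om_alg) :> om_alg.
Proof.
apply: om_ext => G phi phi0; rewrite om_evaM // !om_evE // /ev_poly !big_seq1.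
by rewrite /ev_word !big_seq1 /= ahomM.
Qed.
Definition om_inc : alghom A om_dga :=
  @AlgHom K A om_dga (fun a => omcls [:: [:: inl a]]) om_inc_linear om_inc1 om_incM.

Lemma om_ev_inc (G : dga K) (phi : alghom A G) a :
  (forall a, homog G 0 (phi a)) -> om_ev phi (om_inc a) = phi a.
Proof.
by move=> phi0; rewrite om_evE // /ev_poly big_seq1 /ev_word big_seq1.
Qed.

(* A itself, concentrated in degree 0. *)
Program Definition triv_dga : dga K :=
  @Dga K A (fun n a => if n == 0%N then a else 0) (fun=> 0) _ _ _ _ _ _ _ _ _.
Next Obligation. by case: n => //= c x y; rewrite scaler0 addr0. Qed.
Next Obligation. by move=> c x y; rewrite scaler0 addr0. Qed.
Next Obligation. by case: m n => [|m] [|n] //=; rewrite if_same. Qed.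
Next Obligation. by exists 1%N; rewrite big_ord1. Qed.
Next Obligation.
case: m n H H0 => [|m] [|n] //= H H0; rewrite -?H -?H0 ?mul0r ?mulr0 //.
Qed.
Next Obligation. by rewrite mul0r mulr0 scaler0 addr0. Qed.

Lemma om_inc_inj : injective om_inc.
Proof.
pose phi : alghom A triv_dga :=
  @AlgHom K A triv_dga id (fun _ _ _ => erefl) erefl (fun _ _ => erefl).
have phi0 a : homog triv_dga 0 (phi a) by [].
by move=> a b /(congr1 (om_ev phi)); rewrite !om_ev_inc.
Qed.

Lemma om_inc0 a : homog om_dga 0 (om_inc a).
Proof.
apply: om_ext => G phi phi0; rewrite [LHS](om_ev_proj phi0) om_ev_inc //; exact: phi0.
Qed.

Lemma omcls_cons w s : (omcls (w :: s) : om_alg) = omcls [:: w] + (omcls s : om_alg).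
Proof.
apply: om_ext => G phi phi0; rewrite [RHS](om_evD phi0) !om_evE //.
by rewrite /ev_poly big_seq1 big_cons.
Qed.

Lemma omcls_letter l w : omcls [:: l :: w] =
  (match l with inl a => om_inc a | inr a => dd (om_inc a) end : om_dga)
  * (omcls [:: w] : om_dga).
Proof.
apply: om_ext => G phi phi0; rewrite [RHS](om_evaM phi0) !om_evE //.
rewrite /ev_poly !big_seq1 /ev_word big_cons; congr (_ * _).
by case: l => a; rewrite ?[RHS](om_ev_d phi0) om_ev_inc.
Qed.

Lemma omcls_nil : omcls [::] = 0 :> om_alg.
Proof. by []. Qed.

Lemma om_degree0 (x : om_dga) : homog om_dga 0 x <-> exists a, x = om_inc a.
Proof.
split=> [<-|[a ->]]; last exact: om_inc0.
have -> : dproj 0 x = omcls (pl_proj 0 (omrep x)) by [].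
have : all (fun w => wdeg w == 0%N) (pl_proj 0 (omrep x)) by apply: filter_all.
elim: (pl_proj _ _) => [_|w s IHs]; first by exists 0; rewrite (ahom0 om_inc).
move=> /andP[w0 /IHs[b sb]]; rewrite omcls_cons sb.
suff [a ->] : exists a, (omcls [:: w] : om_dga) = om_inc a.
  by exists (a + b); rewrite (ahomD om_inc).
elim: w w0 {sb} => [_|[a|a] w IHw] //; first by exists 1; rewrite (ahom1 om_inc).
by move=> /IHw[c wc]; exists (a * c); rewrite omcls_letter wc (ahomM om_inc).
Qed.

Lemma om_generated (S : subalgebra om_dga) :
  (forall a, S (om_inc a)) -> (forall a, S (dd (om_inc a))) -> forall x, S x.
Proof.
move=> Sa Sd x; have <- : omcls (omrep x) = x by exact: reprK.
elim: (omrep x) => [|w s IHs]; first exact: subalg0.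
rewrite omcls_cons; apply: subalgD => //; elim: w {s IHs} => [|l w IHw].
  exact: subalg1.
by rewrite omcls_letter; apply: subalgM => //; case: l.
Qed.

Definition Omega : diffalg A := DiffAlg om_inc_inj om_degree0 om_generated.

(* The differential graded algebra map induced by a homomorphism from A to the
   degree 0 part of G. *)
Definition Omega_lift (G : dga K) (phi : alghom A G)
    (phi0 : forall a, homog G 0 (phi a)) : dgahom Omega G :=
  @DgaHom K Omega G (om_evh phi0) (fun x => om_ev_d phi0 x)
    (fun n x => om_ev_proj phi0 n x).

Lemma Omega_liftE (G : dga K) (phi : alghom A G) phi0 a :
  @Omega_lift G phi phi0 (da_inc Omega a) = phi a.
Proof. exact: om_ev_inc. Qed.

End UniversalDGA.

Section Composition.
Variables (K : fieldType) (A B C : ualgType K) (g : alghom B C) (f : alghom A B).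
Lemma ahom_comp_linear : linear (g \o f).
Proof. by move=> a x y /=; rewrite !ahom_linear. Qed.
Lemma ahom_comp1 : (g \o f) 1 = 1.
Proof. by rewrite /= !ahom1. Qed.
Lemma ahom_compM x y : (g \o f) (x * y) = (g \o f) x * (g \o f) y.
Proof. by rewrite /= !ahomM. Qed.
Definition ahom_comp : alghom A C := AlgHom ahom_comp_linear ahom_comp1 ahom_compM.
End Composition.

Section QuotientLift.
Variables (K : fieldType) (A B : ualgType K) (J : ideal A) (f : alghom A B).
Hypothesis fJ : forall x, J x -> f x = 0.
Let q (x : quot J) : B := f (qrep x).
Lemma qliftE x : q (qpi J x) = f x.
Proof. by apply/eqP; rewrite -subr_eq0 -ahomB fJ //; apply: qrep_cls. Qed.
Lemma qlift_linear : linear q.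
Proof.
move=> a x y; rewrite -[x]qrepK -[y]qrepK -[qcls J (qrep x)]/(qpi J _).
by rewrite -[qcls J (qrep y)]/(qpi J _) -ahom_linear !qliftE ahom_linear.
Qed.
Lemma qlift1 : q 1 = 1.
Proof. by rewrite -(ahom1 (qpi J)) qliftE ahom1. Qed.
Lemma qliftM x y : q (x * y) = q x * q y.
Proof.
rewrite -[x]qrepK -[y]qrepK -[qcls J (qrep x)]/(qpi J _).
by rewrite -[qcls J (qrep y)]/(qpi J _) -ahomM !qliftE ahomM.
Qed.
Definition qlift : alghom (quot J) B := AlgHom qlift_linear qlift1 qliftM.
End QuotientLift.

Section Degree0.
Variables (K : fieldType) (A B : ualgType K) (G : diffalg A) (L : diffalg B).
Let f : (A ⊗alg B)%type -> gtens G L := tmap (da_inc G) (da_inc L).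
Let iG a : homog G 0 (da_inc G a). Proof. by apply/da_degree0; exists a. Qed.
Let iL b : homog L 0 (da_inc L b). Proof. by apply/da_degree0; exists b. Qed.
Let fE a b : f (a ⊗ b) = da_inc G a ⊗ da_inc L b.
Proof. by apply: tmapE; apply: ahom_linear. Qed.

Lemma inc0_linear : linear f.
Proof. by apply: tmap_linear; apply: ahom_linear. Qed.
Lemma inc01 : f 1 = 1.
Proof. by rewrite [LHS]fE !ahom1. Qed.
Lemma inc0M x y : f (x * y) = f x * f y.
Proof.
have fD := linfD inc0_linear.
elim/tens_ind: x => [s t hs ht|a b]; first by rewrite mulrDl !fD hs ht mulrDl.
elim/tens_ind: y => [s t hs ht|a' b']; first by rewrite mulrDr !fD hs ht mulrDr.
rewrite [(a ⊗ b : (A ⊗alg B)%type) * _]talg_mulE !fE [RHS]gt_algM.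
by rewrite (gt_mulE _ _ (iL b) (iG a')) scale1r !ahomM.
Qed.

(* The inclusion of A ⊗ B into the graded tensor product of G and L. *)
Definition inc0 : alghom (A ⊗alg B) (gtens G L) := AlgHom inc0_linear inc01 inc0M.

Lemma inc0_homog x : homog (gtens G L) 0 (inc0 x).
Proof.
elim/tens_ind: x => [s t hs ht|a b]; first by rewrite ahomD; apply: homogD.
by rewrite /homog [inc0 _]fE [LHS](gt_projE 0 (iG a) (iL b)).
Qed.
End Degree0.

Section Bundles.
Variable K : fieldType.

(* Locally trivial quantum principal fibre bundles; B_i is quot (qb_ideal i). *)
Record qpfb := Qpfb {
  qb_idx : finType;
  qb_base : ualgType K;
  qb_ideal : qb_idx -> ideal qb_base;
  qb_ideal_complete : complete_covering qb_ideal;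
  qb_hopf : hopf K;
  qb_total : ualgType K;
  qb_coact : alghom qb_total (qb_total ⊗alg qb_hopf);
  qb_coactP : is_coaction (qb_coact : qb_total -> (qb_total ⊗ qb_hopf)%type);
  qb_iota : alghom qb_base qb_total;
  qb_iota_inj : injective qb_iota;
  qb_chi : forall i, alghom qb_total (quot (qb_ideal i) ⊗alg qb_hopf);
  qb_chi_surj : forall i y, exists p, qb_chi i p = y;
  qb_chi_iota : forall i b, qb_chi i (qb_iota b) = qpi (qb_ideal i) b ⊗ (1 : qb_hopf);
  qb_chi_colinear : forall i p, tmap (qb_chi i) id (qb_coact p) = id_comul (qb_chi i p);
  qb_chi_complete : complete_covering (fun i => kernel (qb_chi i))
}.

Variable X : qpfb.
Local Notation I := (qb_idx X).
Local Notation B := (qb_base X).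
Local Notation H := (qb_hopf X).
Local Notation P := (qb_total X).
Local Notation iota := (qb_iota X).
Local Notation chi := (@qb_chi X).
Local Notation coact := (qb_coact X).

Definition qb_loc (i : I) : ualgType K := quot (qb_ideal i).
Local Notation Bl := qb_loc.

Definition local_left_gauge (i : I) (al : (Bl i ⊗alg H)%type -> (Bl i ⊗alg H)%type) :=
  [/\ linear al, bijective al,
      forall (b : Bl i) t, al ((b ⊗ (1 : H) : (Bl i ⊗alg H)%type) * t)
                         = (b ⊗ (1 : H) : (Bl i ⊗alg H)%type) * al t,
      forall t, tmap al id (id_comul t) = id_comul (al t)
    & forall b : Bl i, al (b ⊗ (1 : H)) = b ⊗ (1 : H)].

Definition local_right_gauge (i : I) (al : (Bl i ⊗alg H)%type -> (Bl i ⊗alg H)%type) :=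
  [/\ linear al, bijective al,
      forall (b : Bl i) t, al (t * (b ⊗ (1 : H) : (Bl i ⊗alg H)%type))
                         = al t * (b ⊗ (1 : H) : (Bl i ⊗alg H)%type),
      forall t, tmap al id (id_comul t) = id_comul (al t)
    & forall b : Bl i, al (b ⊗ (1 : H)) = b ⊗ (1 : H)].

Definition left_gauge (al : P -> P) :=
  [/\ linear al, bijective al,
      forall b p, al (iota b * p) = iota b * al p
    & forall i, exists2 ali, local_left_gauge ali & forall p, chi i (al p) = ali (chi i p)].

Definition right_gauge (al : P -> P) :=
  [/\ linear al, bijective al,
      forall b p, al (p * iota b) = al p * iota b
    & forall i, exists2 ali, local_right_gauge ali & forall p, chi i (al p) = ali (chi i p)].

(* g is the map H -> P corresponding to the left gauge transformation al; its
   convolution inverse, the map corresponding to the inverse of al, is handled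
   by left_inverse_map. *)
Definition left_gauge_map (al : P -> P) (g : H -> P) :=
  [/\ linear g, g 1 = 1,
      forall f, al f = \tsum_(f0, f1 <- coact f) f0 * g f1
    & forall h, coact (g h) =
        \tsum_(h1, k <- comul H h) \tsum_(h2, h3 <- comul H k) g h2 ⊗ (antipode h1 * h3)].

Definition left_inverse_map (g g' : H -> P) :=
  forall h, \tsum_(h1, h2 <- comul H h) g h1 * g' h2 = counit h *: (1 : P)
         /\ \tsum_(h1, h2 <- comul H h) g' h1 * g h2 = counit h *: (1 : P).

(* Si stands for the inverse of the antipode. *)
Definition right_gauge_map (Si : H -> H) (al : P -> P) (g : H -> P) :=
  [/\ linear g, g 1 = 1,
      forall f, al f = \tsum_(f0, f1 <- coact f) g f1 * f0
    & forall h, coact (g h) =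
        \tsum_(h1, k <- comul H h) \tsum_(h2, h3 <- comul H k) g h2 ⊗ (h3 * Si h1)].

Definition right_inverse_map (g g' : H -> P) :=
  forall h, \tsum_(h1, h2 <- comul H h) g h2 * g' h1 = counit h *: (1 : P)
         /\ \tsum_(h1, h2 <- comul H h) g' h2 * g h1 = counit h *: (1 : P).

Record diffstruct := DiffStruct {
  ds_base : forall i, diffalg (Bl i);
  ds_hopf : diffalg H;
  ds_covariant : right_covariant ds_hopf
}.

Variable G : diffstruct.

Definition ds_loc (i : I) : dga K := gtens (ds_base G i) (ds_hopf G).

Definition chi0 (i : I) : alghom P (ds_loc i) :=
  ahom_comp (inc0 (ds_base G i) (ds_hopf G)) (chi i).

Lemma chi0_homog i p : homog (ds_loc i) 0 (chi0 i p).
Proof. exact: inc0_homog. Qed.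

Definition chiOmega (i : I) : dgahom (Omega P) (ds_loc i) := Omega_lift (@chi0_homog i).

Definition JP (i : I) : ideal (Omega P) := kernel (chiOmega i).

(* The differential algebra Γ(P); its differential, induced by that of Ω(P), is
   carried by chiGamma i to the differential of ds_loc i, see chiGamma_dd. *)
Definition GammaP : ualgType K := quot (ideal_cap JP).

Lemma chiOmega_cap i x : ideal_cap JP x -> chiOmega i x = 0.
Proof. by apply. Qed.

Definition chiGamma (i : I) : alghom GammaP (ds_loc i) := qlift (@chiOmega_cap i).

Lemma chiGammaE i w : chiGamma i (qpi (ideal_cap JP) w) = chiOmega i w.
Proof. exact: (qliftE (@chiOmega_cap i)). Qed.

Lemma chiGamma_dd i w :
  chiGamma i (qpi (ideal_cap JP) (dd w)) = dd (chiGamma i (qpi (ideal_cap JP) w)).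
Proof. by rewrite !chiGammaE (dgahom_dd (chiOmega i)). Qed.

Definition KP (i : I) : ideal GammaP := kernel (chiGamma i).

(* The families forming Γ_c(P): the class of x in Γ(P)/K_i is identified with
   its image chiGamma i x. *)
Definition glued (gamma : prodalg ds_loc) := forall i j, exists x y : GammaP,
  [/\ chiGamma i x = gamma i, chiGamma j y = gamma j
    & qpi (ideal_add (KP i) (KP j)) x = qpi (ideal_add (KP i) (KP j)) y].

Lemma glued1 : glued 1.
Proof. by move=> i j; exists 1, 1; split; rewrite // ahom1. Qed.
Lemma glued_lin a x y : glued x -> glued y -> glued (a *: x + y).
Proof.
move=> hx hy i j; have [u [v [ui vj uv]]] := hx i j; have [u' [v' [ui' vj' uv']]] := hy i j.
by exists (a *: u + u'), (a *: v + v'); split; rewrite !ahom_linear ?ui ?ui' ?vj ?vj' ?uv ?uv'.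
Qed.
Lemma gluedM x y : glued x -> glued y -> glued (x * y).
Proof.
move=> hx hy i j; have [u [v [ui vj uv]]] := hx i j; have [u' [v' [ui' vj' uv']]] := hy i j.
by exists (u * u'), (v * v'); split; rewrite !ahomM ?ui ?ui' ?vj ?vj' ?uv ?uv'.
Qed.

Definition GammaC : ualgType K := subalg (Subalgebra glued1 glued_lin gluedM).

Definition chiC (i : I) : alghom GammaC (ds_loc i) :=
  ahom_comp (pr_proj (fun i => dga_alg (ds_loc i)) i) (sa_val _).

Definition prod_d (gamma : prodalg ds_loc) : prodalg ds_loc := fun i => dd (gamma i).

Lemma GammaP_lift (x : GammaP) : exists w, x = qpi (ideal_cap JP) w.
Proof. by exists (qrep x); rewrite -[LHS]qrepK. Qed.

Lemma KP_d i (w : Omega P) :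
  KP i (qpi (ideal_cap JP) w) -> KP i (qpi (ideal_cap JP) (dd w)).
Proof.
move=> h; have {}h : chiGamma i (qpi (ideal_cap JP) w) = 0 := h.
by rewrite -[KP i _]/(chiGamma i _ = 0) chiGamma_dd h (linf0 (@dd_linear _ _)).
Qed.

Lemma prod_d_glued gamma : glued gamma -> glued (prod_d gamma).
Proof.
move=> h i j; have [x [y [xi yj xy]]] := h i j.
have [u xE] := GammaP_lift x; have [v yE] := GammaP_lift y; subst x y.
exists (qpi (ideal_cap JP) (dd u)), (qpi (ideal_cap JP) (dd v)).
split; [by rewrite chiGamma_dd xi|by rewrite chiGamma_dd yj|].
move/qclsP: xy => [s [t [Ks Kt st]]].
have [s' sE] := GammaP_lift s; have [t' tE] := GammaP_lift t; subst s t.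
apply/qclsP; exists (qpi _ (dd s')), (qpi _ (dd t')); split; try exact: KP_d.
have : ideal_cap JP (u - v - (s' + t')).
  by apply/qclsP; move: st; rewrite -ahomB -ahomD.
move=> h'; rewrite -ahomB -ahomD; apply/qclsP => k.
have -> : dd u - dd v - (dd s' + dd t') = dd (u - v - (s' + t')).
  have dL := @dd_linear _ (Omega P); have dN z : dd (- z) = - dd z :> Omega P.
    by rewrite -scaleN1r (linfZ dL) scaleN1r.
  by rewrite !(linfD dL, dN).
have hk : chiOmega k (u - v - (s' + t')) = 0 := h' k.
by rewrite -[JP k _]/(chiOmega k _ = 0) (dgahom_dd (chiOmega k)) hk (linf0 (@dd_linear _ _)).
Qed.

(* The differential of Γ_c(P) is taken componentwise. *)
Definition dC (gamma : GammaC) : GammaC :=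
  sa_in (prod_d_glued (subalg_eltP gamma) : Subalgebra glued1 glued_lin gluedM (prod_d _)).

(* The inclusion of Γ(B_i) ⊗ H into Γ(B_i) ⊗^ Γ(H). *)
Definition incH (i : I) (t : (ds_base G i ⊗ H)%type) : ds_loc i :=
  tmap id (da_inc (ds_hopf G)) t.

Lemma incH_linear i : linear (@incH i).
Proof. by apply: tmap_linear => //; apply: ahom_linear. Qed.

Lemma incHE i x h : @incH i (x ⊗ h) = x ⊗ da_inc (ds_hopf G) h.
Proof. by apply: tmapE => //; apply: ahom_linear. Qed.

Lemma incHM i (s t : (ds_base G i ⊗ H)%type) :
  exists r, @incH i r = incH s * incH t.
Proof.
have iL := @incH_linear i.
elim/tens_ind: s => [s s' [r rE] [r' rE']|x h].
  by exists (r + r'); rewrite !(linfD iL) mulrDl rE rE'.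
elim/tens_ind: t => [t t' [r rE] [r' rE']|y k].
  by exists (r + r'); rewrite !(linfD iL) mulrDr rE rE'.
exists (x * y ⊗ (h * k)); rewrite !incHE [RHS]gt_algM ahomM.
elim/homog_ind: y => [y y' hy hy'|n y hy].
  rewrite mulrDr !(bilinDl (@tens_bilin _ _ _)) hy hy'.
  by rewrite (bilinDr (@gt_mul_bilin _ _ _)).
have h0 : homog (ds_hopf G) 0 (da_inc (ds_hopf G) h) by apply/da_degree0; exists h.
by rewrite (gt_mulE _ _ h0 hy) mul0n scale1r.
Qed.

Definition horizontal (gamma : GammaC) := forall i, exists t, chiC i gamma = incH t.

Lemma horizontal1 : horizontal 1.
Proof.
by move=> i; exists ((1 : ds_base G i) ⊗ (1 : H)); rewrite incHE !ahom1.
Qed.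
Lemma horizontal_lin a x y : horizontal x -> horizontal y -> horizontal (a *: x + y).
Proof.
move=> hx hy i; have [s xi] := hx i; have [t yi] := hy i.
by exists (a *: s + t); rewrite ahom_linear xi yi incH_linear.
Qed.
Lemma horizontalM x y : horizontal x -> horizontal y -> horizontal (x * y).
Proof.
move=> hx hy i; have [s xi] := hx i; have [t yi] := hy i; have [r rE] := incHM s t.
by exists r; rewrite ahomM xi yi rE.
Qed.

Definition hor : ualgType K := subalg (Subalgebra horizontal1 horizontal_lin horizontalM).

Definition chiH (i : I) : alghom hor (ds_loc i) := ahom_comp (chiC i) (sa_val _).

Definition hor_homog (n : nat) (gamma : hor) :=
  forall i, homog (ds_loc i) n (chiH i gamma).

(* Membership in Γ_m(B). *)
Definition basic (gamma : GammaC) := forall i, exists x : ds_base G i,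
  chiC i gamma = x ⊗ (1 : ds_hopf G).

Lemma basic1 : basic 1.
Proof. by move=> i; exists 1; rewrite ahom1. Qed.
Lemma basic_lin a x y : basic x -> basic y -> basic (a *: x + y).
Proof.
move=> hx hy i; have [s xi] := hx i; have [t yi] := hy i.
exists (a *: s + t); rewrite ahom_linear xi yi.
by rewrite (bilinDl (@tens_bilin _ _ _)) (bilinZl (@tens_bilin _ _ _)).
Qed.
Lemma basicM x y : basic x -> basic y -> basic (x * y).
Proof.
move=> hx hy i; have [s xi] := hx i; have [t yi] := hy i.
exists (s * t); rewrite ahomM xi yi [LHS]gt_algM.
elim/homog_ind: t {yi} => [t t' ht ht'|n t ht].
  rewrite mulrDr !(bilinDl (@tens_bilin _ _ _)) -ht -ht'.
  by rewrite (bilinDr (@gt_mul_bilin _ _ _)).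
by rewrite (gt_mulE _ _ (dproj1 _) ht) mul0n scale1r mulr1.
Qed.

Definition GammaM : ualgType K := subalg (Subalgebra basic1 basic_lin basicM).

Definition chiM (i : I) : alghom GammaM (ds_loc i) := ahom_comp (chiC i) (sa_val _).

Lemma dC_basic gamma : basic gamma -> basic (dC gamma).
Proof.
move=> h i; have [x xi] := h i; exists (dd x).
have -> : chiC i (dC gamma) = dd (chiC i gamma) by [].
rewrite xi; elim/homog_ind: x {xi} => [x y hx hy|n x hx].
  rewrite !(bilinDl (@tens_bilin _ _ _)) !(linfD (@dd_linear _ _)).
  by rewrite (bilinDl (@tens_bilin _ _ _)) hx hy.
rewrite [LHS](gt_dE _ hx) dd1.
by rewrite (bilin0r (@tens_bilin _ _ _)) scaler0 addr0.
Qed.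

Definition dM (rho : GammaM) : GammaM :=
  sa_in (dC_basic (subalg_eltP rho) : Subalgebra basic1 basic_lin basicM (dC _)).

Lemma basic_horizontal gamma : basic gamma -> horizontal gamma.
Proof.
by move=> h i; have [x xi] := h i; exists (x ⊗ (1 : H)); rewrite incHE ahom1.
Qed.

Definition incM (rho : GammaM) : hor :=
  sa_in (basic_horizontal (subalg_eltP rho)
         : Subalgebra horizontal1 horizontal_lin horizontalM (sa_val _ rho)).

(* The inclusion of P = Γ_c^0(P) into hor Γ_c(P). *)
Lemma chi0_glued p : glued (fun i => chi0 i p).
Proof.
move=> i j; exists (qpi _ (da_inc (Omega P) p)), (qpi _ (da_inc (Omega P) p)).
by split=> //; rewrite chiGammaE [LHS]Omega_liftE.
Qed.

Definition incC (p : P) : GammaC :=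
  sa_in (chi0_glued p : Subalgebra glued1 glued_lin gluedM (fun i => chi0 i p)).

Lemma incC_horizontal p : horizontal (incC p).
Proof.
move=> i; have -> : chiC i (incC p) = inc0 (ds_base G i) (ds_hopf G) (chi i p) by [].
elim/tens_ind: (chi i p) => [s t [s' sE] [t' tE]|b h].
  by exists (s' + t'); rewrite ahomD sE tE (linfD (@incH_linear i)).
exists (da_inc (ds_base G i) b ⊗ h); rewrite incHE.
by apply: tmapE; apply: ahom_linear.
Qed.

Definition incP_fun (p : P) : hor :=
  sa_in (incC_horizontal p
         : Subalgebra horizontal1 horizontal_lin horizontalM (incC p)).

Lemma hor_ext (x y : hor) : (forall i, chiH i x = chiH i y) -> x = y.
Proof.
move=> h; do 2!apply: subalg_elt_inj; exact: functional_extensionality_dep.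
Qed.

Lemma incP_linear : linear incP_fun.
Proof.
move=> a x y; apply: hor_ext => i; rewrite ahom_linear.
exact: (ahom_linear (chi0 i)).
Qed.
Lemma incP1 : incP_fun 1 = 1.
Proof. by apply: hor_ext => i; rewrite ahom1; apply: (ahom1 (chi0 i)). Qed.
Lemma incPM x y : incP_fun (x * y) = incP_fun x * incP_fun y.
Proof. by apply: hor_ext => i; rewrite ahomM; apply: (ahomM (chi0 i)). Qed.
Definition incP : alghom P hor := AlgHom incP_linear incP1 incPM.

(* rho is the right coaction of H on hor Γ_c(P): it extends the coaction of P
   and is given on each Γ(B_i) ⊗ H by id ⊗ Δ.  The last condition determines
   rho, since the maps chiH i are jointly injective. *)
Definition hor_coaction (rho : hor -> (hor ⊗ H)%type) :=
  [/\ is_coaction rho,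
      forall p, rho (incP p) = tmap incP id (coact p)
    & forall i gamma t, chiH i gamma = incH t ->
        tmap (chiH i) id (rho gamma) = tmap (@incH i) id (id_comul t)].

Section CovariantDerivatives.
Variable rho : hor -> (hor ⊗ H)%type.

(* The actions on hor Γ_c(P) of the gauge transformations with map g. *)
Definition left_act (g : H -> P) (gamma : hor) : hor :=
  \tsum_(gamma0, gamma1 <- rho gamma) gamma0 * incP (g gamma1).

Definition right_act (g : H -> P) (gamma : hor) : hor :=
  \tsum_(gamma0, gamma1 <- rho gamma) incP (g gamma1) * gamma0.

Definition precovariant (D : hor -> hor) :=
  [/\ linear D /\ (forall n gamma, hor_homog n gamma -> hor_homog n.+1 (D gamma)),
      D 1 = 0,
      forall gamma, rho (D gamma) = tmap D id (rho gamma)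
    & forall i gamma, chiH i gamma = 0 -> chiH i (D gamma) = 0].

Definition left_covariant_derivative (D : hor -> hor) :=
  precovariant D /\
  forall n (r : GammaM) gamma, hor_homog n (incM r) ->
    D (incM r * gamma) = incM (dM r) * gamma + (-1) ^+ n *: (incM r * D gamma).

Definition right_covariant_derivative (D : hor -> hor) :=
  precovariant D /\
  forall n gamma (r : GammaM), hor_homog n gamma ->
    D (gamma * incM r) = D gamma * incM r + (-1) ^+ n *: (gamma * incM (dM r)).

Definition left_curvature (D : hor -> hor) (Om : H -> hor) :=
  [/\ linear Om,
      forall h, hor_homog 2 (Om h)
    & forall f, D (D (incP f)) = \tsum_(f0, f1 <- coact f) incP f0 * Om f1].

Definition right_curvature (D : hor -> hor) (Om : H -> hor) :=
  [/\ linear Om,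
      forall h, hor_homog 2 (Om h)
    & forall f, D (D (incP f)) = \tsum_(f0, f1 <- coact f) Om f1 * incP f0].

End CovariantDerivatives.
End Bundles.

(* Main.v *)
(* For p in P the curvature formula and colinearity of D give
   D'^2(p) = α(D^2(α^-1(p))) = Σ α^-1(p_0) Ω(p_1) g(p_2)
           = Σ p_0 g'(p_1) Ω(p_2) g(p_3),
   because α^-1 is colinear.  Cancelling α^-1 against α on hor Γ_c(P) and
   the uniqueness of the curvature form are checked in the local algebras
   Γ(B_i) ⊗ H. *)

Require Import Defs.
From mathcomp Require Import all_boot all_order all_algebra.
From mathcomp Require Import reals complex.
Local Open Scope ring_scope.
Local Open Scope complex_scope.
Import GRing.Theory.
Set Implicit Arguments.
Unset Strict Implicit.
Unset Printing Implicit Defensive.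

(** * Sweedler calculus *)

Section LinearMaps.
Variables (K : fieldType) (U V W T : lmodType K).

Lemma linear_comp (f : V -> W) (g : U -> V) :
  linear f -> linear g -> linear (fun x => f (g x)).
Proof. by move=> fL gL a x y; rewrite gL fL. Qed.

Lemma linear_bilinl (f : V -> W -> T) (g : U -> V) w :
  bilin f -> linear g -> linear (fun x => f (g x) w).
Proof. by move=> fB gL a x y; rewrite gL fB.1. Qed.

Lemma linear_bilinr (f : W -> V -> T) (g : U -> V) w :
  bilin f -> linear g -> linear (fun x => f w (g x)).
Proof. by move=> fB gL a x y; rewrite gL fB.2. Qed.

Lemma linear_tsum (F : U -> V -> W -> T) t :
  (forall v w, linear (fun x => F x v w)) -> linear (fun x => tsum t (F x)).
Proof.
move=> FL a x y; rewrite /tsum /formal_sum scaler_sumr -big_split /=.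
by apply: eq_bigr => p _; rewrite FL.
Qed.

Lemma linear_tsuml (F : V -> W -> T) (t : U -> (V ⊗ W)%type) :
  bilin F -> linear t -> linear (fun x => tsum (t x) F).
Proof. by move=> FB tL a x y; rewrite tL (tsum_linear FB). Qed.

Lemma linear_scaler a (g : U -> V) : linear g -> linear (fun x => a *: g x).
Proof. by move=> gL c x y; rewrite gL scalerDr !scalerA mulrC. Qed.

Lemma linear_scalel (e : U -> K) (v : V) :
  linear (e : U -> K^o) -> linear (fun x => e x *: v).
Proof. by move=> eL c x y; rewrite eL scalerDl -scalerA. Qed.

Lemma linear_tsumE (F : V -> W -> T) (f : T -> U) t :
  linear f -> f (tsum t F) = \tsum_(v, w <- t) f (F v w).
Proof. by move=> fL; rewrite /tsum /formal_sum (linf_sum fL). Qed.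
End LinearMaps.

(* Reversing the product turns the formulas for right gauge transformations into
   those for left ones, with the inverse antipode as antipode. *)
Definition omul (K : fieldType) (b : bool) (A : ualgType K) (x y : A) : A :=
  if b then y * x else x * y.

Section OppositeProduct.
Variables (K : fieldType) (b : bool).
Implicit Types A B : ualgType K.

Lemma omul_bilin A : bilin (@omul K b A).
Proof.
by rewrite /omul; split=> z a x y; case: b; rewrite ?mulrDl ?mulrDr -?uscalerAl -?uscalerAr.
Qed.

Lemma omulA A : associative (@omul K b A).
Proof. by rewrite /omul => x y z; case: b; rewrite mulrA. Qed.

Lemma omul1l A : left_id 1 (@omul K b A).
Proof. by rewrite /omul => x; case: b; rewrite (mulr1, mul1r). Qed.

Lemma omul1r A : right_id 1 (@omul K b A).
Proof. by rewrite /omul => x; case: b; rewrite (mulr1, mul1r). Qed.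

Lemma ahom_omul A B (f : alghom A B) x y : f (omul b x y) = omul b (f x) (f y).
Proof. by rewrite /omul; case: b; rewrite ahomM. Qed.

Lemma talg_omulE A B (x x' : A) (y y' : B) :
  omul b (x ⊗ y : (A ⊗alg B)%type) (x' ⊗ y') = omul b x x' ⊗ omul b y y'.
Proof. by rewrite /omul; case: b; apply: talg_mulE. Qed.
End OppositeProduct.

(** [tsum] is computed on a chosen representative, so evaluating it on tensors requires a bilinear
    summand. [lin] proves such side conditions by recursion on the expression, drawing on the
    linearity facts in the context. *)
Ltac lin :=
  cbv beta;
  lazymatch goal with
  | |- bilin _ => first [assumption | exact: tens_bilin | exact: omul_bilin | split=> ?; lin]
  | |- GRing.linear_for _ (ahom_fun ?f) => exact: (ahom_linear f)
  | |- GRing.linear_for _ (tmap _ _) => apply: tmap_linear; lin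
  | |- GRing.linear_for _ _ =>
    first [ by [] | exact: counit_linear | exact: antipode_linear
          | apply: linear_tsum => ? ?; lin
          | apply: linear_tsuml; lin
          | apply: (linear_bilinl (f := tens)); lin
          | apply: (linear_bilinr (f := tens)); lin
          | apply: (linear_bilinl (f := @omul _ _ _)); lin
          | apply: (linear_bilinr (f := @omul _ _ _)); lin
          | apply: linear_scaler; lin
          | apply: linear_scalel; lin
          | apply: (linear_comp (f := ahom_fun _)); lin
          | apply: (linear_comp (f := tmap _ _)); lin
          | apply: (linear_comp (f := @antipode _ _)); lin
          | match goal with
            | fB : bilin ?f |- _ =>
              first [apply: (linear_bilinl (f := f)); lin | apply: (linear_bilinr (f := f)); lin]
            | fL : GRing.linear_for _ ?f |- _ => apply: (linear_comp (f := f)); lin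
            end ]
  end.

Definition trilin (K : fieldType) (U V W T : lmodType K) (F : U -> V -> W -> T) :=
  [/\ forall v w, linear (fun u => F u v w), forall u w, linear (fun v => F u v w)
    & forall u v, linear (F u v)].

Section Sweedler.
Variable K : fieldType.

Lemma tsum_tmap (U V U' V' W : lmodType K) (f : U -> U') (g : V -> V')
    (F : U' -> V' -> W) t :
  linear f -> linear g -> bilin F ->
  tsum (tmap f g t) F = \tsum_(u, v <- t) F (f u) (g v).
Proof.
move=> fL gL [FL FR]; elim/tens_ind: t => [s t hs ht|u v].
  rewrite (linfD (tmap_linear fL gL)) !(linfD (tsum_linear _)) ?hs ?ht //.
  by split=> ? a x y; rewrite ?fL ?gL ?FL ?FR.
by rewrite tmapE // !tsumE //; split=> ? a x y; rewrite ?fL ?gL ?FL ?FR.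
Qed.

Lemma tmap_comp (U V U' V' U'' V'' : lmodType K) (f : U -> U') (g : V -> V')
    (f' : U' -> U'') (g' : V' -> V'') t :
  linear f -> linear g -> linear f' -> linear g' ->
  tmap f' g' (tmap f g t) = tmap (fun u => f' (f u)) (fun v => g' (g v)) t.
Proof. by move=> fL gL f'L g'L; rewrite [LHS]tsum_tmap //; apply: tmap_bilin. Qed.

Lemma tsum_tens (U V : lmodType K) (t : (U ⊗ V)%type) : \tsum_(u, v <- t) u ⊗ v = t.
Proof.
have tL := tsum_linear (@tens_bilin K U V).
elim/tens_ind: t => [s t hs ht|u v]; first by rewrite (linfD tL) hs ht.
by rewrite tsumE //; apply: tens_bilin.
Qed.

Lemma tsum_tassoc (U V W T : lmodType K) (G : U -> (V ⊗ W)%type -> T) t :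
  bilin G ->
  tsum (tassoc t) G = \tsum_(p, w <- t) \tsum_(u, v <- p) G u (v ⊗ w).
Proof.
move=> GB; rewrite /tassoc (linear_tsumE _ _ (tsum_linear GB)).
apply: eq_tsum => p w; rewrite (linear_tsumE _ _ (tsum_linear GB)).
by apply: eq_tsum => u v; rewrite tsumE.
Qed.

Lemma tsum_tassocV (U V W T : lmodType K) (G : (U ⊗ V)%type -> W -> T) t :
  bilin G ->
  tsum (tassocV t) G = \tsum_(u, q <- t) \tsum_(v, w <- q) G (u ⊗ v) w.
Proof.
move=> GB; rewrite /tassocV (linear_tsumE _ _ (tsum_linear GB)).
apply: eq_tsum => p w; rewrite (linear_tsumE _ _ (tsum_linear GB)).
by apply: eq_tsum => u v; rewrite tsumE.
Qed.

Variable H : hopf K.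
Local Notation Δ := (comul H).

Lemma tsum_id_comul (M T : lmodType K) (G : (M ⊗ H)%type -> H -> T) t :
  bilin G ->
  tsum (id_comul t) G = \tsum_(m, h <- t) \tsum_(h1, h2 <- Δ h) G (m ⊗ h1) h2.
Proof.
by move=> GB; rewrite tsum_tassocV // tsum_tmap //; lin.
Qed.

(** Pairs both sides of the coassociativity axiom of [rho] with [F]: the two nestings are the two
    readings of m_0 ⊗ m_1 ⊗ m_2. *)
Lemma tsum_coact (M T : lmodType K) (rho : M -> (M ⊗ H)%type)
    (F : M -> H -> H -> T) m : is_coaction rho -> trilin F ->
  \tsum_(m0, h <- rho m) \tsum_(m00, m01 <- rho m0) F m00 m01 h
  = \tsum_(m0, h <- rho m) \tsum_(h1, h2 <- Δ h) F m0 h1 h2.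
Proof.
move=> [rhoL rhoA _] [F1 F2 F3].
have FB h : bilin (fun m h1 => F m h1 h) by split=> ?; lin.
have GB : bilin (fun (p : (M ⊗ H)%type) h => \tsum_(m, h1 <- p) F m h1 h).
  by split=> v; lin.
transitivity (tsum (tmap rho id (rho m)) (fun p h => \tsum_(m, h1 <- p) F m h1 h)).
  by rewrite tsum_tmap.
rewrite rhoA tsum_id_comul //; apply: eq_tsum => x h; apply: eq_tsum => h1 h2.
by rewrite tsumE.
Qed.

(** The same pairing for Δ. It serves to bring two neighbouring factors under one inner coproduct,
    where a Hopf axiom can act on them. *)
Lemma tsum_comulA (T : lmodType K) (F : H -> H -> H -> T) h : trilin F ->
  \tsum_(k, z <- Δ h) \tsum_(x, y <- Δ k) F x y z
  = \tsum_(x, k <- Δ h) \tsum_(y, z <- Δ k) F x y z.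
Proof.
move=> [F1 F2 F3].
have FB x : bilin (F x) by split=> ?; lin.
have ΔL := @ahom_linear _ _ _ (Δ).
transitivity (tsum (tassoc (tmap Δ id (Δ h))) (fun x q => \tsum_(y, z <- q) F x y z)).
  rewrite tsum_tassoc; last by split=> v; lin.
  rewrite tsum_tmap //; last by split=> v; lin.
  by apply: eq_tsum => x h1; apply: eq_tsum => u v; rewrite tsumE.
by rewrite comulA tsum_tmap // ; split=> v; lin.
Qed.

Lemma tsum_counitl (T : lmodType K) (f : H -> T) h : linear f ->
  \tsum_(x, y <- Δ h) counit x *: f y = f h.
Proof.
move=> fL; rewrite -[in RHS](counitl h) linear_tsumE //.
by apply: eq_tsum => x y; rewrite (linfZ fL).
Qed.

Lemma tsum_counitr (T : lmodType K) (f : H -> T) h : linear f ->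
  \tsum_(x, y <- Δ h) counit y *: f x = f h.
Proof.
move=> fL; rewrite -[in RHS](counitr h) linear_tsumE //.
by apply: eq_tsum => x y; rewrite (linfZ fL).
Qed.

Lemma tsum_talgM (A B : ualgType K) (T : lmodType K) (F : A -> B -> T)
    (s t : (A ⊗alg B)%type) : bilin F ->
  tsum (s * t) F = \tsum_(x, y <- s) \tsum_(x', y' <- t) F (x * x') (y * y').
Proof.
move=> FB; rewrite [s * t]/(talg_mul s t) /talg_mul.
rewrite (linear_tsumE _ _ (tsum_linear FB)).
apply: eq_tsum => p w; rewrite (linear_tsumE _ _ (tsum_linear FB)).
by apply: eq_tsum => u v; rewrite tsumE.
Qed.

(** Both sides are one finite double sum over the chosen representatives of [s] and [t]. *)
Lemma exchange_tsum (U V U' V' W : lmodType K) (F : U -> V -> U' -> V' -> W) s t :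
  \tsum_(u, v <- s) \tsum_(u', v' <- t) F u v u' v'
  = \tsum_(u', v' <- t) \tsum_(u, v <- s) F u v u' v'.
Proof. by rewrite /tsum /formal_sum exchange_big. Qed.

(* Both sides contract S(x1 y1) x2 y2 S(y3) S(x3). *)
Lemma antipodeM (x y : H) : antipode (x * y) = antipode y * antipode x.
Proof.
pose m := @omul K false H.
pose F x1 x2 x3 y1 y2 y3 :=
  m (antipode (m x1 y1)) (m x2 (m y2 (m (antipode y3) (antipode x3)))).
transitivity (\tsum_(x1, k <- Δ x) \tsum_(x2, x3 <- Δ k)
    \tsum_(y1, l <- Δ y) \tsum_(y2, y3 <- Δ l) F x1 x2 x3 y1 y2 y3).
  (* Inner pairs on the right: y2 S(y3) and then x2 S(x3) collapse to counits and leave S(xy). Here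
     this is read backwards, inserting the counit of x first. *)
  rewrite -[LHS](tsum_counitr (f := fun x1 => antipode (m x1 y))); last by rewrite /m; lin.
  apply: eq_tsum => x1 k.
  pose f z := m (antipode (m x1 y)) z.
  have fL : linear f by rewrite /f /m; lin.
  transitivity (f (counit k *: (1 : H))); first by rewrite (linfZ fL) /f /m omul1r.
  rewrite -antipoder (linear_tsumE _ _ fL); apply: eq_tsum => x2 x3.
  pose g y1 := m (antipode (m x1 y1)) (m x2 (antipode x3)).
  have gL : linear g by rewrite /g /m; lin.
  rewrite -[LHS](tsum_counitr y gL); apply: eq_tsum => y1 l.
  pose e z := m (antipode (m x1 y1)) (m x2 (m z (antipode x3))).
  have eL : linear e by rewrite /e /m; lin.
  transitivity (e (counit l *: (1 : H))); first by rewrite (linfZ eL) /e /m omul1l.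
  rewrite -antipoder (linear_tsumE _ _ eL); apply: eq_tsum => y2 y3.
  by rewrite /e /F /m -omulA.
transitivity (\tsum_(k, x3 <- Δ x) \tsum_(x1, x2 <- Δ k)
    \tsum_(l, y3 <- Δ y) \tsum_(y1, y2 <- Δ l) F x1 x2 x3 y1 y2 y3).
  rewrite tsum_comulA; last by rewrite /F /m; split=> *; lin.
  apply: eq_tsum => x1 k; apply: eq_tsum => x2 x3.
  by rewrite tsum_comulA //; rewrite /F /m; split=> *; lin.
(* Inner pairs on the left: as Δ is multiplicative, S(x1 y1) x2 y2 sums to the counit of [k * l],
   which leaves S(y) S(x). *)
rewrite -[RHS](tsum_counitl (f := fun x3 => m (antipode y) (antipode x3))); last by rewrite /m; lin.
apply: eq_tsum => k x3; rewrite exchange_tsum.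
have hL : linear (fun y3 => counit k *: m (antipode y3) (antipode x3)) by rewrite /m; lin.
rewrite -[RHS](tsum_counitl y hL); apply: eq_tsum => l y3.
pose e z := m z (m (antipode y3) (antipode x3)).
have eL : linear e by rewrite /e /m; lin.
transitivity (e (counit (k * l) *: (1 : H))); last first.
  by rewrite (linfZ eL) /e /m omul1l counitM scalerA mulrC.
rewrite -antipodel ahomM tsum_talgM; last first.
  by apply: (_ : bilin (fun a b => omul false (antipode a) b)); lin.
rewrite (linear_tsumE _ _ eL); apply: eq_tsum => x1 x2.
rewrite (linear_tsumE _ _ eL); apply: eq_tsum => y1 y2.
by rewrite /e /F /m /omul !mulrA.
Qed.

(** The antipode axiom at 1, where Δ(1) = 1 ⊗ 1. *)
Lemma antipode1 : antipode (1 : H) = 1.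
Proof.
have := antipodel (1 : H); rewrite ahom1 tsumE; last first.
  have SL := @antipode_linear K H.
  by apply: (_ : bilin (fun x y => omul false (antipode x) y)); lin.
by rewrite mulr1 counit1 scale1r.
Qed.

(** The form of the antipode axioms common to both sides: S satisfies them for the product of [H],
    and its inverse for the opposite product, with the same coproduct. *)
Definition convolution_antipode (b : bool) (s : H -> H) :=
  [/\ linear s,
      forall h, \tsum_(x, y <- Δ h) omul b (s x) y = counit h *: (1 : H)
    & forall h, \tsum_(x, y <- Δ h) omul b x (s y) = counit h *: (1 : H)].

(** The inverse of S is antimultiplicative because S is. Applying it to S(h_1) h_2 and to h_1 S(h_2)
    gives the two axioms for the opposite product. *)
Lemma inverse_antipode_convolution (Si : H -> H) :
  cancel (@antipode K H) Si -> cancel Si (@antipode K H) -> convolution_antipode true Si.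
Proof.
move=> SK SiK.
have SL := @antipode_linear K H.
have SiL : linear Si.
  by move=> a x y; rewrite -{1}[x]SiK -{1}[y]SiK -SL SK.
have Si1 : Si 1 = 1 by rewrite -{1}antipode1 SK.
have eS h : counit h *: (1 : H) = Si (counit h *: (1 : H)) by rewrite (linfZ SiL) Si1.
have SiM x y : Si (x * y) = Si y * Si x by rewrite -{1}[x]SiK -{1}[y]SiK -antipodeM SK.
split=> // h; rewrite eS.
  rewrite -antipoder (linear_tsumE _ _ SiL).
  by apply: eq_tsum => x y; rewrite SiM SK.
rewrite -antipodel (linear_tsumE _ _ SiL).
by apply: eq_tsum => x y; rewrite SiM SK.
Qed.

Lemma antipode_convolution : convolution_antipode false (@antipode K H).
Proof. by split; [apply: antipode_linear|apply: antipodel|apply: antipoder]. Qed.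

End Sweedler.

(** * Gauge transformations of comodule algebras *)

Section ComoduleAlgebra.
Variables (K : fieldType) (b : bool) (H : hopf K) (s : H -> H).
Hypothesis sP : convolution_antipode b s.
Variables (M : ualgType K) (δ : alghom M (M ⊗alg H)).
Hypothesis δP : is_coaction (δ : M -> (M ⊗ H)%type).
Local Notation Δ := (comul H).

(** Stated for any comodule algebra, since it is applied both to P and to the local algebras Γ(B_i)
    ⊗ H. *)
Definition gauge_act (g : H -> M) (m : M) : M :=
  \tsum_(m0, m1 <- δ m) omul b m0 (g m1).

Lemma gauge_act_linear g : linear g -> linear (gauge_act g).
Proof. by move=> gL; rewrite /gauge_act; lin. Qed.

(** Equivariance of [g] for the adjoint coaction h ↦ h_2 ⊗ S(h_1) h_3, or its variant for the
    opposite product. *)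
Definition gauge_covariant (g : H -> M) := forall h, δ (g h) =
  \tsum_(h1, k <- Δ h) \tsum_(h2, h3 <- Δ k) g h2 ⊗ omul b (s h1) h3.

(* The factor [s h1] of [gcov] meets the [H]-leg of the coaction of [m] and
   cancels it by the antipode axiom. *)
Lemma gauge_act_colinear g m : linear g -> gauge_covariant g ->
  δ (gauge_act g m) = tmap (gauge_act g) id (δ m).
Proof.
move=> gL gcov; have [sL _ sr] := sP; have aL := gauge_act_linear gL.
have δL : linear (δ : M -> (M ⊗ H)%type) := ahom_linear δ.
rewrite {1}/gauge_act (linear_tsumE _ _ δL).
pose mm (z w : (M ⊗ H)%type) : (M ⊗ H)%type := omul b (z : (M ⊗alg H)%type) w.
have mmB : bilin mm := @omul_bilin _ b (M ⊗alg H)%type.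
pose F m0 h1 h2 := mm (m0 ⊗ h1) (δ (g h2)).
transitivity (\tsum_(m0, h <- δ m) \tsum_(m00, m01 <- δ m0) F m00 m01 h).
  apply: eq_tsum => m0 h; rewrite ahom_omul.
  rewrite -[LHS]/(mm (δ m0) (δ (g h))) -[X in mm X _]tsum_tens.
  by rewrite (linear_tsumE _ _ (mmB.1 (δ (g h)))).
rewrite tsum_coact //; last by rewrite /F; split=> *; lin.
transitivity (\tsum_(m0, h <- δ m) \tsum_(m00, m01 <- δ m0) omul b m00 (g m01) ⊗ h).
  rewrite tsum_coact //; last by split=> *; lin.
  apply: eq_tsum => m0 h.
  (* [R] sums to m_0 g(h_3) ⊗ h_1 s(h_2) h_4. Regrouping by [tsum_comulA] puts h_1 and s(h_2) under
     one coproduct, where they cancel. *)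
  pose R h1 k1 l := \tsum_(k2, k3 <- Δ l)
    omul b m0 (g k2) ⊗ omul b (omul b h1 (s k1)) k3 : (M ⊗ H)%type.
  transitivity (\tsum_(h1, h2 <- Δ h) \tsum_(k1, l <- Δ h2) R h1 k1 l).
    apply: eq_tsum => h1 h2; rewrite /F gcov.
    rewrite (linear_tsumE _ _ (mmB.2 _)); apply: eq_tsum => k1 l.
    rewrite (linear_tsumE _ _ (mmB.2 _)); apply: eq_tsum => k2 k3.
    by rewrite /mm talg_omulE omulA.
  rewrite -tsum_comulA; last by rewrite /R; split=> *; lin.
  have GL : linear (fun l => \tsum_(k2, k3 <- Δ l) omul b m0 (g k2) ⊗ k3) by lin.
  rewrite -[RHS](tsum_counitl h GL); apply: eq_tsum => k l.
  pose e z := \tsum_(k2, k3 <- Δ l) omul b m0 (g k2) ⊗ omul b z k3 : (M ⊗ H)%type.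
  have eL : linear e by rewrite /e; lin.
  transitivity (e (counit k *: (1 : H))); first by rewrite -sr (linear_tsumE _ _ eL).
  by rewrite (linfZ eL) /e; congr (_ *: _); apply: eq_tsum => k2 k3; rewrite omul1l.
apply: eq_tsum => m0 h; have tL := (@tens_bilin _ M H).1 h.
by rewrite /gauge_act (linear_tsumE _ _ tL).
Qed.

(** Colinearity of the first action turns the composite into m_0 g(m_1) g'(m_2); the convolution
    identity and the counit axiom then leave m. *)
Lemma gauge_act_inverse g g' m : linear g -> linear g' -> gauge_covariant g ->
  (forall h, \tsum_(h1, h2 <- Δ h) omul b (g h1) (g' h2) = counit h *: (1 : M)) ->
  gauge_act g' (gauge_act g m) = m.
Proof.
move=> gL g'L gcov gg'; have aL := gauge_act_linear gL.
rewrite {1}/gauge_act gauge_act_colinear // tsum_tmap //; last by lin.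
transitivity (\tsum_(m0, h <- δ m) \tsum_(m00, m01 <- δ m0)
    omul b (omul b m00 (g m01)) (g' h)).
  apply: eq_tsum => m0 h; have tL := (@omul_bilin _ b M).1 (g' h).
  by rewrite {1}/gauge_act (linear_tsumE _ _ tL).
rewrite tsum_coact //; last by split=> *; lin.
case: δP => _ _ eps; rewrite -[RHS]eps; apply: eq_tsum => m0 h.
have mL := (@omul_bilin _ b M).2 m0.
transitivity (omul b m0 (counit h *: (1 : M))); last by rewrite (linfZ mL) omul1r.
rewrite -gg' (linear_tsumE _ _ mL); by apply: eq_tsum => h1 h2; rewrite omulA.
Qed.
End ComoduleAlgebra.

(** * The comodules M ⊗ H with coaction id ⊗ Δ *)

Section TensorComodule.
Variables (K : fieldType) (H : hopf K).
Local Notation Δ := (comul H).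

Lemma id_comul_tsum (M : lmodType K) (t : (M ⊗ H)%type) :
  id_comul t = \tsum_(m, h <- t) \tsum_(h1, h2 <- Δ h) m ⊗ h1 ⊗ h2.
Proof. by rewrite -[LHS]tsum_tens tsum_id_comul //; lin. Qed.

Lemma id_comul_linear (M : lmodType K) : linear (@id_comul K H M).
Proof.
have h : linear (fun t : (M ⊗ H)%type =>
    \tsum_(m, h <- t) \tsum_(h1, h2 <- Δ h) m ⊗ h1 ⊗ h2).
  by lin.
by move=> a x y; rewrite !id_comul_tsum h.
Qed.

Lemma id_comulE (M : lmodType K) (m : M) (h : H) :
  id_comul (m ⊗ h) = \tsum_(h1, h2 <- Δ h) m ⊗ h1 ⊗ h2.
Proof. by rewrite id_comul_tsum tsumE //; lin. Qed.

Lemma id_comul_coassoc (M : lmodType K) (t : (M ⊗ H)%type) :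
  tmap (@id_comul K H M) id (id_comul t) = id_comul (id_comul t).
Proof.
have cL := id_comul_linear.
elim/tens_ind: t => [s t hs ht|m h].
  by rewrite !(linfD (cL _)) (linfD (tmap_linear _ _)) ?hs ?ht.
rewrite id_comulE (linear_tsumE _ _ (cL _)) linear_tsumE; last by apply: tmap_linear.
under eq_tsum => h1 h2.
  rewrite tmapE // id_comulE (linear_tsumE _ _ ((@tens_bilin _ _ _).1 h2)); over.
under [RHS]eq_tsum => h1 h2 do rewrite id_comulE.
by rewrite tsum_comulA //; split=> *; lin.
Qed.

(** This is the cofree comodule on [M]: its axioms are coassociativity and the counit law of Δ on
    the second leg. *)
Lemma id_comul_coaction (M : lmodType K) : is_coaction (@id_comul K H M).
Proof.
have cL := id_comul_linear; split=> // [t|t]; first exact: id_comul_coassoc.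
have eL := @counit_linear K H.
have sB : bilin (fun (m : (M ⊗ H)%type) (h : H) => counit h *: m) by split=> ?; lin.
elim/tens_ind: t => [s t hs ht|m h].
  by rewrite (linfD (cL _)) (linfD (tsum_linear sB)) hs ht.
rewrite id_comulE (linear_tsumE _ _ (tsum_linear sB)).
under eq_tsum => h1 h2 do rewrite tsumE //.
by rewrite (tsum_counitr (f := fun h1 => m ⊗ h1)) //; lin.
Qed.

Section Algebra.
Variable A : ualgType K.
Local Notation AH := (A ⊗alg H)%type.

Lemma id_comul1 : id_comul (1 : AH) = 1 :> (AH ⊗alg H)%type.
Proof. by rewrite [LHS]id_comulE ahom1 tsumE //; lin. Qed.

(** Inherited from multiplicativity of Δ. It makes [AH] a comodule algebra, to which [gauge_act]
    applies. *)
Lemma id_comulM (x y : AH) :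
  id_comul (x * y) = (id_comul x : (AH ⊗alg H)%type) * id_comul y :> (AH ⊗alg H)%type.
Proof.
have cD := linfD (@id_comul_linear A).
elim/tens_ind: x => [s t hs ht|a h]; first by rewrite mulrDl !cD mulrDl hs ht.
elim/tens_ind: y => [s t hs ht|a' h']; first by rewrite mulrDr !cD mulrDr hs ht.
rewrite [(a ⊗ h : AH) * _]talg_mulE !id_comulE ahomM tsum_talgM; last by lin.
have mB := talg_mul_bilin AH H.
rewrite [RHS](linear_tsumE _ _ (mB.1 _)); apply: eq_tsum => h1 h2.
rewrite [RHS](linear_tsumE _ _ (mB.2 _)); apply: eq_tsum => h1' h2'.
by rewrite talg_mulE; congr (_ ⊗ _); rewrite [RHS]talg_mulE.
Qed.

Definition id_comul_ahom : alghom AH (AH ⊗alg H)%type :=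
  @AlgHom K AH (AH ⊗alg H)%type (@id_comul K H A) (@id_comul_linear A) id_comul1 id_comulM.
End Algebra.

Section TensorId.
Variables (A A' : ualgType K) (f : alghom A A').
Local Notation fid := (tmap f id : (A ⊗alg H)%type -> (A' ⊗alg H)%type).

Lemma tmap_id_linear : linear fid.
Proof. by apply: tmap_linear => //; apply: ahom_linear. Qed.

Lemma tmap_idE a h : fid (a ⊗ h) = f a ⊗ h.
Proof. by apply: tmapE => //; apply: ahom_linear. Qed.

Lemma tmap_id1 : fid 1 = 1.
Proof. by rewrite [LHS]tmap_idE ahom1. Qed.

Lemma tmap_idM x y : fid (x * y) = fid x * fid y.
Proof.
have fD := linfD tmap_id_linear.
elim/tens_ind: x => [s t hs ht|a h]; first by rewrite mulrDl !fD mulrDl hs ht.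
elim/tens_ind: y => [s t hs ht|a' h']; first by rewrite mulrDr !fD mulrDr hs ht.
by rewrite [(a ⊗ h : (A ⊗alg H)%type) * _]talg_mulE !tmap_idE [RHS]talg_mulE ahomM.
Qed.

Definition tmap_id_ahom : alghom (A ⊗alg H)%type (A' ⊗alg H)%type :=
  AlgHom tmap_id_linear tmap_id1 tmap_idM.

Lemma tmap_id_colinear t : tmap fid id (id_comul t) = id_comul (fid t).
Proof.
have fL := tmap_id_linear; have cL := id_comul_linear.
elim/tens_ind: t => [s t hs ht|a h].
  by rewrite (linfD fL) !(linfD (cL _)) (linfD (tmap_linear fL _)) ?hs ?ht.
rewrite tmap_idE !id_comulE linear_tsumE; last exact: tmap_linear.
by apply: eq_tsum => h1 h2; rewrite tmapE // tmap_idE.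
Qed.
End TensorId.
End TensorComodule.

(** * Gauge transformations of horizontal forms *)

Section GaugeCurvature.
Variables (K : fieldType) (X : qpfb K) (G : diffstruct X).
Local Notation H := (qb_hopf X).
Local Notation P := (qb_total X).
Local Notation Δ := (comul H).
Local Notation coact := (qb_coact X).
Local Notation hor := (hor G).

(** * The local comodule algebras Γ(B_i) ⊗ H *)

Section LocalModel.
Variable i : qb_idx X.
Local Notation M := (ds_base G i ⊗alg H)%type.

(** [M] carries the ungraded product, the target the graded one. They agree because [H] sits in
    degree 0 of Γ(H), so exchanging h with a form gives no sign. *)
Lemma incH_ahomM (x y : M) : incH (x * y) = incH x * incH y.
Proof.
have iD := linfD (@incH_linear _ _ G i).
elim/tens_ind: x => [s t hs ht|a h]; first by rewrite mulrDl !iD mulrDl hs ht.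
elim/tens_ind: y => [s t hs ht|a' k]; first by rewrite mulrDr !iD mulrDr hs ht.
rewrite [(a ⊗ h : M) * _]talg_mulE !incHE [RHS]gt_algM ahomM.
have h0 : homog (ds_hopf G) 0 (da_inc (ds_hopf G) h) by apply/da_degree0; exists h.
elim/homog_ind: a' => [y y' hy hy'|n y hy].
  rewrite mulrDr !(bilinDl (@tens_bilin _ _ _)) hy hy'.
  by rewrite (bilinDr (@gt_mul_bilin _ _ _)).
by rewrite (gt_mulE _ _ h0 hy) mul0n scale1r.
Qed.

Lemma incH_omul b (x y : M) : incH (omul b x y) = omul b (incH x) (incH y).
Proof. by rewrite /omul; case: b; rewrite incH_ahomM. Qed.

(** χ_i with values enlarged from B_i ⊗ H to Γ(B_i) ⊗ H, so that elements of P and horizontal forms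
    are compared in one algebra. *)
Definition chi_form : alghom P M :=
  ahom_comp (tmap_id_ahom H (da_inc (ds_base G i))) (@qb_chi _ X i).

Lemma chi_form_colinear p :
  tmap chi_form id (coact p) = id_comul (chi_form p).
Proof.
have cL := ahom_linear (@qb_chi _ X i).
have iL := @tmap_id_linear _ H _ _ (da_inc (ds_base G i)).
rewrite [chi_form p]/(tmap _ id _) -tmap_id_colinear -qb_chi_colinear.
by rewrite tmap_comp.
Qed.

Lemma chiH_incP p : chiH G i (incP G p) = incH (chi_form p).
Proof.
rewrite -[LHS]/(tmap (da_inc _) (da_inc _) (@qb_chi _ X i p)).
by rewrite -[chi_form p]/(tmap (da_inc _) id _) /incH tmap_comp //;
  apply: ahom_linear.
Qed.
End LocalModel.

Variables (b : bool) (s : H -> H).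
Hypothesis sP : convolution_antipode b s.
Variable rho : hor -> (hor ⊗ H)%type.
Hypothesis rhoP : hor_coaction rho.

(** This is [left_act] for [b = false] and [right_act] for [b = true], by computation. *)
Definition hor_act (g : H -> P) (gamma : hor) : hor :=
  \tsum_(gamma0, gamma1 <- rho gamma) omul b gamma0 (incP G (g gamma1)).

(** As [rho] is locally id ⊗ Δ, the action becomes the one of the comodule algebra Γ(B_i) ⊗ H with
    gauge map χ_i ∘ g. *)
Lemma chiH_hor_act i g gamma t : linear g -> chiH G i gamma = incH t ->
  chiH G i (hor_act g gamma)
  = incH (gauge_act b (id_comul_ahom H _) (fun h => chi_form i (g h)) t).
Proof.
case: rhoP => _ _ rloc gL ti.
have cL := ahom_linear (chiH G i); have iL := @incH_linear _ _ G i.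
rewrite /hor_act (linear_tsumE _ _ cL) /gauge_act (linear_tsumE _ _ iL).
transitivity (\tsum_(w, h <- tmap (chiH G i) id (rho gamma)) omul b w (chiH G i (incP G (g h)))).
  by rewrite tsum_tmap //; [apply: eq_tsum => x h; rewrite ahom_omul|lin].
rewrite (rloc _ _ _ ti) tsum_tmap //; last by lin.
by apply: eq_tsum => x h; rewrite incH_omul chiH_incP.
Qed.

(* [rho] is not known to be multiplicative on hor Γ_c(P), hence the detour
   through the comodule algebras Γ(B_i) ⊗ H. *)
Lemma hor_act_inverse g g' gamma : linear g -> linear g' ->
  gauge_covariant b s coact g ->
  (forall h, \tsum_(h1, h2 <- Δ h) omul b (g h1) (g' h2) = counit h *: (1 : P)) ->
  hor_act g' (hor_act g gamma) = gamma.
Proof.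
move=> gL g'L gcov gg'; apply: hor_ext => i.
have [t ti] := subalg_eltP gamma i; rewrite -[chiC G i _]/(chiH G i gamma) in ti.
rewrite (chiH_hor_act g'L (chiH_hor_act gL ti)) (gauge_act_inverse sP) //.
- exact: id_comul_coaction.
- by lin.
- by lin.
(* Covariance of χ_i ∘ g is the image of that of [g] under the colinear map χ_i. *)
- move=> h; rewrite -[LHS]chi_form_colinear gcov.
  have cL := ahom_linear (chi_form i).
  rewrite linear_tsumE; last exact: tmap_linear.
  apply: eq_tsum => h1 k; rewrite linear_tsumE; last exact: tmap_linear.
  by apply: eq_tsum => h2 h3; rewrite tmapE.
- move=> h; have cL := ahom_linear (chi_form i).
  transitivity (chi_form i (counit h *: (1 : P))); last by rewrite ahomZ ahom1.
  rewrite -gg' (linear_tsumE _ _ cL); apply: eq_tsum => h1 h2.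
  by rewrite ahom_omul.
Qed.

Lemma hor_act_incP g p : linear g ->
  hor_act g (incP G p) = incP G (gauge_act b coact g p).
Proof.
case: rhoP => _ rext _ gL; have iL := ahom_linear (incP G).
rewrite /hor_act rext tsum_tmap //; last by lin.
by rewrite (linear_tsumE _ _ iL); apply: eq_tsum => p0 p1; rewrite ahom_omul.
Qed.

(* Locally, test against the f with χ_i(f) = 1 ⊗ h; convolving with the
   antipode then isolates Ω. *)
Lemma curvature_unique (Om Om' : H -> hor) : linear Om -> linear Om' ->
  (forall f, \tsum_(f0, f1 <- coact f) omul b (incP G f0) (Om f1)
           = \tsum_(f0, f1 <- coact f) omul b (incP G f0) (Om' f1)) ->
  Om =1 Om'.
Proof.
move=> OL O'L eqO h; apply: hor_ext => i.
have [sL sl _] := sP.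
pose j (k : H) : ds_loc G i := incH ((1 : ds_base G i) ⊗ k).
have jL : linear j.
  by have iL := @incH_linear _ _ G i; rewrite /j; lin.
have j1 : j 1 = 1 by rewrite /j incHE !ahom1.
have jM x y : j (omul b x y) = omul b (j x) (j y).
  by rewrite /j -incH_omul talg_omulE omul1l.
have cL := ahom_linear (chiH G i).
(* Inserting s(h_1) h_2 = ε recovers χ_i(Q(h)) from the convolution of [j] with χ_i ∘ Q. *)
have key (Q : H -> hor) : linear Q -> chiH G i (Q h) =
    \tsum_(x, k <- Δ h) omul b (j (s x)) (\tsum_(y, z <- Δ k) omul b (j y) (chiH G i (Q z))).
  move=> QL; have QcL : linear (fun z => chiH G i (Q z)) by lin.
  transitivity (\tsum_(x, k <- Δ h) \tsum_(y, z <- Δ k)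
      omul b (omul b (j (s x)) (j y)) (chiH G i (Q z))).
    rewrite -tsum_comulA; last by split=> *; lin.
    rewrite -[LHS](tsum_counitl h QcL); apply: eq_tsum => k z.
    pose e y := omul b (j y) (chiH G i (Q z)).
    have eL : linear e by rewrite /e; lin.
    transitivity (e (counit k *: (1 : H))); first by rewrite (linfZ eL) /e j1 omul1l.
    by rewrite -sl (linear_tsumE _ _ eL); apply: eq_tsum => x y; rewrite /e jM.
  apply: eq_tsum => x k; have mL := (@omul_bilin _ b (ds_loc G i)).2 (j (s x)).
  by rewrite (linear_tsumE _ _ mL); apply: eq_tsum => y z; rewrite omulA.
rewrite (key Om) // (key Om') //; apply: eq_tsum => x k; congr (omul b _ _).
have [f fk] := @qb_chi_surj _ X i ((1 : qb_loc i) ⊗ k).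
(* As χ_i(f) = 1 ⊗ k, colinearity gives χ_i(f_0) ⊗ f_1 = 1 ⊗ k_1 ⊗ k_2, so the curvature formula at
   f yields that convolution at k. *)
have loc (Q : H -> hor) : linear Q ->
    chiH G i (\tsum_(f0, f1 <- coact f) omul b (incP G f0) (Q f1))
    = \tsum_(y, z <- Δ k) omul b (j y) (chiH G i (Q z)).
  move=> QL; rewrite (linear_tsumE _ _ cL).
  have iL := @incH_linear _ _ G i; have fL := ahom_linear (chi_form i).
  transitivity (\tsum_(w, z <- tmap (chi_form i) id (coact f)) omul b (incH w) (chiH G i (Q z))).
    by rewrite tsum_tmap //; [apply: eq_tsum => u v; rewrite ahom_omul chiH_incP|lin].
  have fE : chi_form i f = (1 : ds_base G i) ⊗ k.
    by rewrite -[LHS]/(tmap _ id _) fk tmap_idE ahom1.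
  have wB : bilin (fun w z => omul b (incH w) (chiH G i (Q z))) by lin.
  rewrite chi_form_colinear fE id_comulE (linear_tsumE _ _ (tsum_linear wB)).
  by apply: eq_tsum => y z; rewrite tsumE.
by rewrite -!loc ?eqO.
Qed.

(** Covariance of [g] serves the cancellation of α^{-1} against α on forms, that of [g'] the
    colinearity of α^{-1} on P. *)
Lemma gauge_curvature (D : hor -> hor) (Om Om' : H -> hor) (g g' : H -> P) :
  linear D -> (forall gamma, rho (D gamma) = tmap D id (rho gamma)) ->
  linear Om -> linear Om' -> linear g -> linear g' ->
  gauge_covariant b s coact g -> gauge_covariant b s coact g' ->
  (forall h, \tsum_(h1, h2 <- Δ h) omul b (g h1) (g' h2) = counit h *: (1 : P)) ->
  (forall f, D (D (incP G f)) = \tsum_(f0, f1 <- coact f) omul b (incP G f0) (Om f1)) ->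
  (forall f, hor_act g (D (hor_act g' (hor_act g (D (hor_act g' (incP G f))))))
    = \tsum_(f0, f1 <- coact f) omul b (incP G f0) (Om' f1)) ->
  forall h, Om' h = \tsum_(h1, k <- Δ h) \tsum_(h2, h3 <- Δ k)
    omul b (omul b (incP G (g' h1)) (Om h2)) (incP G (g h3)).
Proof.
move=> DL Drho OL O'L gL g'L gcov g'cov gg' D2 D'2.
have iL := ahom_linear (incP G); have aL := gauge_act_linear b coact g'L.
apply: curvature_unique => //; first by lin.
move=> f; rewrite -D'2 (hor_act_inverse _ gL) // hor_act_incP //.
set p := gauge_act b coact g' f.
pose D2' x := D (D x); have D2L : linear D2' by rewrite /D2'; lin.
(* D^2 commutes with the coaction because D does, so α acts on D^2(p) as D^2(p_0) g(p_1). *)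
have rD2 : rho (D2' (incP G p)) = tmap (fun q => D2' (incP G q)) id (coact p).
  case: rhoP => _ rext _; rewrite /D2' !Drho rext.
  by rewrite !tmap_comp //; lin.
rewrite -[D (D _)]/(D2' _) /hor_act rD2 tsum_tmap //; [|by lin..].
rewrite /p (gauge_act_colinear sP (qb_coactP X)) // tsum_tmap //; last by lin.
(* [E] collects f_0 g'(f_1) Ω(f_2) g(f_3) with the last two legs still under one coproduct, ready
   for coassociativity of the coaction. *)
pose E x y z := \tsum_(h2, h3 <- Δ z) omul b (incP G x)
  (omul b (omul b (incP G (g' y)) (Om h2)) (incP G (g h3))).
transitivity (\tsum_(x, k <- coact f) \tsum_(y, z <- Δ k) E x y z); last first.
  apply: eq_tsum => x k; have mL := (@omul_bilin _ b hor).2 (incP G x).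
  rewrite (linear_tsumE _ _ mL); apply: eq_tsum => y z.
  by rewrite (linear_tsumE _ _ mL).
rewrite -(tsum_coact _ (qb_coactP X)); last by rewrite /E; split=> *; lin.
transitivity (\tsum_(a, k <- coact f) \tsum_(u, c <- Δ k)
    omul b (omul b (incP G (gauge_act b coact g' a)) (Om u)) (incP G (g c))).
  rewrite -(tsum_coact _ (qb_coactP X)); last by split=> *; lin.
  apply: eq_tsum => f0 f1; rewrite /D2' D2.
  rewrite (gauge_act_colinear sP (qb_coactP X)) // tsum_tmap //; last by lin.
  by rewrite (linear_tsumE _ _ ((@omul_bilin _ b hor).1 _)).
(* What remains is to expand α^{-1}(a) as a_0 g'(a_1), which is linear in the first factor. *)
apply: eq_tsum => a k; rewrite /E exchange_tsum.
apply: eq_tsum => u c.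
pose e q := omul b (omul b (incP G q) (Om u)) (incP G (g c)).
have eL : linear e by rewrite /e; lin.
rewrite -[LHS]/(e _) (linear_tsumE _ _ eL); apply: eq_tsum => x y.
by rewrite /e ahom_omul !omulA.
Qed.
End GaugeCurvature.

(** * The transformation law for left and right curvature forms *)

Theorem proposition13 (R : realType) (X : qpfb R[i])
    (Si : qb_hopf X -> qb_hopf X)
    (antipodeK : cancel (@antipode _ (qb_hopf X)) Si)
    (antipodeVK : cancel Si (@antipode _ (qb_hopf X)))
    (G : diffstruct X)
    (rho : hor G -> (hor G ⊗ qb_hopf X)%type) (rhoP : hor_coaction rho) :
  (forall (D : hor G -> hor G) (Om Om' : qb_hopf X -> hor G)
      (al al' : qb_total X -> qb_total X) (g g' : qb_hopf X -> qb_total X),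
    left_covariant_derivative rho D ->
    left_curvature D Om ->
    left_gauge al -> cancel al al' -> cancel al' al ->
    left_gauge_map al g -> left_gauge_map al' g' -> left_inverse_map g g' ->
    left_curvature (left_act rho g \o D \o left_act rho g') Om' ->
    forall h, Om' h = \tsum_(h1, k <- comul (qb_hopf X) h)
                        \tsum_(h2, h3 <- comul (qb_hopf X) k)
                          incP G (g' h1) * Om h2 * incP G (g h3))
  /\
  (forall (D : hor G -> hor G) (Om Om' : qb_hopf X -> hor G)
      (al al' : qb_total X -> qb_total X) (g g' : qb_hopf X -> qb_total X),
    right_covariant_derivative rho D ->
    right_curvature D Om ->
    right_gauge al -> cancel al al' -> cancel al' al ->
    right_gauge_map Si al g -> right_gauge_map Si al' g' -> right_inverse_map g g' ->
    right_curvature (right_act rho g \o D \o right_act rho g') Om' ->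
    forall h, Om' h = \tsum_(h1, k <- comul (qb_hopf X) h)
                        \tsum_(h2, h3 <- comul (qb_hopf X) k)
                          incP G (g h3) * Om h2 * incP G (g' h1)).
Proof.
split=> D Om Om' al al' g g' [[[DL _] _ Drho _] _] [OL _ D2] _ _ _.
  move=> [gL _ _ gcov] [g'L _ _ g'cov] gg' [O'L _ D'2].
  exact: (gauge_curvature (b := false) (antipode_convolution _) rhoP DL Drho OL O'L gL g'L
    gcov g'cov (fun h => (gg' h).1) D2 D'2).
move=> [gL _ _ gcov] [g'L _ _ g'cov] gg' [O'L _ D'2] h.
(* Under the opposite product the required convolution identity is g'(h_2) g(h_1) = ε(h) 1, the
   second half of [right_inverse_map]. *)
rewrite (gauge_curvature (b := true) (inverse_antipode_convolution antipodeK antipodeVK)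
  rhoP DL Drho OL O'L gL g'L gcov g'cov (fun h => (gg' h).2) D2 D'2).
by apply: eq_tsum => h1 k; apply: eq_tsum => h2 h3; rewrite /omul mulrA.
Qed.
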